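(* For any $\Sigma_0$-formula $\varphi(x_1,\dots,x_n)$ with free variables among $x_1,\dots,x_n$ and any $1\le i\le n$, there is a term $\mathcal G_\varphi$ of $n$ arguments built (by composition) from the fundamental operations such that \[ \mathsf{IKP}^{-\mathrm{Inf}}\vdash \mathcal G_\varphi(a,x_1,\dots,x_{i-1},x_{i+1},\dots,x_n)=\{x_i\in a:\varphi(x_1,\dots,x_n)\}. \]
   Context: $\mathsf{IKP}^{-\mathrm{Inf}}$ is the theory with intuitionistic logic whose axioms are Extensionality, Empty Set, Pairing, Unions, Set Induction scheme, $\Sigma_0$-Separation scheme and $\Sigma_0$-Collection scheme (no axiom of infinity). $\langle a,b\rangle=\{\{a\},\{a,b\}\}$, $\langle a,b,c\rangle=\langle a,\langle b,c\rangle\rangle$; $1^{st}(x)=a$, $2^{nd}(x)=b$ when $x=\langle a,b\rangle$. The fundamental operations are the binary operations: $\{x,y\}$; $x\cap\bigcap y$; $\bigcup x$; $x\setminus y$; $x\times y$; $x\cap\{z: y\text{ is an ordered pair}\wedge(z\in 1^{st}(y)\to z\in 2^{nd}(y))\}$; $\{\{u:\langle z,u\rangle\in x\}:z\in y\}$; $\mathrm{dom}(x)=\{1^{st}(z):z\in x,\ z\text{ an ordered pair}\}$; $\mathrm{ran}(x)=\{2^{nd}(z):z\in x,\ z\text{ an ordered pair}\}$; $\{\langle u,v,w\rangle:\langle u,v\rangle\in x\wedge w\in y\}$; $\{\langle u,w,v\rangle:\langle u,v\rangle\in x\wedge w\in y\}$; $\{\langle v,u\rangle\in y\times x:u=v\}$;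 $\{\langle v,u\rangle\in y\times x:u\in v\}$. *)

(* Defs.v *)
From Stdlib Require List.
From mathcomp Require Import all_boot.
Set Implicit Arguments.
Unset Strict Implicit.
Unset Printing Implicit Defensive.

(** Well-scoped de Bruijn syntax: a formula in [form n] has its free variables
    among the [n] variables ['I_n]. The language has no function symbols, so the
    only terms of the logic are variables. A quantifier binds variable 0 of its
    body and [shift] sends a variable into the scope of one more binder. *)

Inductive form (n : nat) : Type :=
| fbot
| fmem of 'I_n & 'I_n
| feq of 'I_n & 'I_n
| fand of form n & form n
| for_ of form n & form n
| fimp of form n & form n
| fall of form n.+1
| fex of form n.+1.

Arguments fbot {n}.

Definition shift {n} (x : 'I_n) : 'I_n.+1 := lift ord0 x.

Definition v0 {n} : 'I_n.+1 := ord0.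
Definition v1 {n} : 'I_n.+2 := shift v0.
Definition v2 {n} : 'I_n.+3 := shift v1.

Declare Scope set_formula_scope.
Delimit Scope set_formula_scope with sf.
Bind Scope set_formula_scope with form.

Notation "↑ x" := (shift x) (at level 9, right associativity, format "↑ x").
Notation "⊥" := fbot : set_formula_scope.
Notation "x ∈ y" := (fmem x y) (at level 70, no associativity) : set_formula_scope.
Notation "x ≐ y" := (feq x y) (at level 70, no associativity) : set_formula_scope.
Notation "¬ A" := (fimp A fbot) (at level 75, right associativity) : set_formula_scope.
Notation "A ∧ B" := (fand A B) (at level 80, right associativity) : set_formula_scope.
Notation "A ∨ B" := (for_ A B) (at level 85, right associativity) : set_formula_scope.
Notation "A ⇒ B" := (fimp A B) (at level 90, right associativity) : set_formula_scope.
Notation "A ⇔ B" := (fand (fimp A B) (fimp B A)) (at level 95, no associativity)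
  : set_formula_scope.
Notation "∀' A" := (fall A) (at level 200, right associativity) : set_formula_scope.
Notation "∃' A" := (fex A) (at level 200, right associativity) : set_formula_scope.

(** Bounded quantifiers; the bound [y] lives outside the binder, so it is
    always distinct from the quantified variable. *)
Notation "∀∈ y , A" := (fall (fimp (fmem v0 (shift y)) A))
  (at level 200, y at level 9, right associativity) : set_formula_scope.
Notation "∃∈ y , A" := (fex (fand (fmem v0 (shift y)) A))
  (at level 200, y at level 9, right associativity) : set_formula_scope.

Local Open Scope set_formula_scope.

(** [insert i a f] maps variable [i] to [a] and the [j]-th of the remaining
    variables to [f j]. *)
Definition insert {A : Type} {n} (i : 'I_n.+1) (a : A) (f : 'I_n -> A)
    (k : 'I_n.+1) : A :=
  if unlift i k is Some j then f j else a.

Definition up {m n} (f : 'I_m -> 'I_n) : 'I_m.+1 -> 'I_n.+1 :=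
  insert ord0 v0 (fun j => ↑(f j)).

Fixpoint ren {m n} (f : 'I_m -> 'I_n) (A : form m) : form n :=
  match A with
  | fbot => ⊥
  | fmem x y => f x ∈ f y
  | feq x y => f x ≐ f y
  | fand A B => ren f A ∧ ren f B
  | for_ A B => ren f A ∨ ren f B
  | fimp A B => ren f A ⇒ ren f B
  | fall A => ∀' ren (up f) A
  | fex A => ∃' ren (up f) A
  end.

Definition inst {n} (y : 'I_n) (A : form n.+1) : form n :=
  ren (insert ord0 y id) A.

Inductive Sigma0 : forall n, form n -> Prop :=
| Sigma0_bot n : Sigma0 (⊥ : form n)
| Sigma0_mem n (x y : 'I_n) : Sigma0 (x ∈ y)
| Sigma0_eq n (x y : 'I_n) : Sigma0 (x ≐ y)
| Sigma0_and n (A B : form n) : Sigma0 A -> Sigma0 B -> Sigma0 (A ∧ B)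
| Sigma0_or n (A B : form n) : Sigma0 A -> Sigma0 B -> Sigma0 (A ∨ B)
| Sigma0_imp n (A B : form n) : Sigma0 A -> Sigma0 B -> Sigma0 (A ⇒ B)
| Sigma0_all n (y : 'I_n) (A : form n.+1) : Sigma0 A -> Sigma0 (∀∈ y, A)
| Sigma0_ex n (y : 'I_n) (A : form n.+1) : Sigma0 A -> Sigma0 (∃∈ y, A).

(** A theory is given by axioms [T n A] with [n] parameters;
    as they may be used in every context, this amounts to taking the universal
    closures of the [T n A] as axioms. *)

Definition theory := forall n, form n -> Prop.

Inductive proves (T : theory) : forall n, seq (form n) -> form n -> Prop :=
| prAx n (G : seq (form n)) A : T n A -> proves T G A
| prHyp n (G : seq (form n)) A : List.In A G -> proves T G A
| prBotE n (G : seq (form n)) A : proves T G ⊥ -> proves T G A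
| prAndI n (G : seq (form n)) A B :
    proves T G A -> proves T G B -> proves T G (A ∧ B)
| prAndE1 n (G : seq (form n)) A B : proves T G (A ∧ B) -> proves T G A
| prAndE2 n (G : seq (form n)) A B : proves T G (A ∧ B) -> proves T G B
| prOrI1 n (G : seq (form n)) A B : proves T G A -> proves T G (A ∨ B)
| prOrI2 n (G : seq (form n)) A B : proves T G B -> proves T G (A ∨ B)
| prOrE n (G : seq (form n)) A B C :
    proves T G (A ∨ B) -> proves T (A :: G) C -> proves T (B :: G) C ->
    proves T G C
| prImpI n (G : seq (form n)) A B : proves T (A :: G) B -> proves T G (A ⇒ B)
| prImpE n (G : seq (form n)) A B :
    proves T G (A ⇒ B) -> proves T G A -> proves T G B
| prAllI n (G : seq (form n)) (A : form n.+1) :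
    proves T (map (ren shift) G) A -> proves T G (∀' A)
| prAllE n (G : seq (form n)) (A : form n.+1) (y : 'I_n) :
    proves T G (∀' A) -> proves T G (inst y A)
| prExI n (G : seq (form n)) (A : form n.+1) (y : 'I_n) :
    proves T G (inst y A) -> proves T G (∃' A)
| prExE n (G : seq (form n)) (A : form n.+1) B :
    proves T G (∃' A) -> proves T (A :: map (ren shift) G) (ren shift B) ->
    proves T G B
| prEqI n (G : seq (form n)) (x : 'I_n) : proves T G (x ≐ x)
| prEqE n (G : seq (form n)) (A : form n.+1) (x y : 'I_n) :
    proves T G (x ≐ y) -> proves T G (inst x A) -> proves T G (inst y A).

Notation "T ⊢ A" := (proves T [::] A) (at level 99, A at level 200, no associativity).

Inductive IKP_minus_Inf : theory :=
| ax_extensionality n :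
    IKP_minus_Inf
      ((∀' ∀' ((∀' (v0 ∈ v1 ⇔ v0 ∈ v2)) ⇒ v0 ≐ v1)) : form n)
| ax_empty n :
    IKP_minus_Inf ((∃' ∀' ¬ v0 ∈ v1) : form n)
| ax_pairing n (x y : 'I_n) :
    IKP_minus_Inf (∃' ∀' (v0 ∈ v1 ⇔ v0 ≐ ↑↑x ∨ v0 ≐ ↑↑y))
| ax_union n (x : 'I_n) :
    IKP_minus_Inf (∃' ∀' (v0 ∈ v1 ⇔ (∃∈ ↑↑x, v1 ∈ v0)))
| ax_set_induction n (A : form n.+1) :
    IKP_minus_Inf ((∀' ((∀∈ v0, ren (up shift) A) ⇒ A)) ⇒ ∀' A)
| ax_Sigma0_separation n (a : 'I_n) (A : form n.+1) :
    Sigma0 A ->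
    IKP_minus_Inf (∃' ∀' (v0 ∈ v1 ⇔ v0 ∈ ↑↑a ∧ ren (up shift) A))
| ax_Sigma0_collection n (a : 'I_n) (A : form n.+2) :
    (* in [A], [v1] ranges over [a] and [v0] is the value to be collected *)
    Sigma0 A ->
    IKP_minus_Inf
      ((∀∈ a, ∃' A) ⇒ ∃' ∀∈ ↑a, ∃∈ v1, ren (up (up shift)) A).

(** p = {x, y} *)
Definition is_pair {n} (p x y : 'I_n) : form n :=
  ∀' (v0 ∈ ↑p ⇔ v0 ≐ ↑x ∨ v0 ≐ ↑y).

(** p = <x, y> = {{x}, {x, y}} *)
Definition is_opair {n} (p x y : 'I_n) : form n :=
  ∃' ∃' (is_pair v1 ↑↑x ↑↑x ∧ is_pair v0 ↑↑x ↑↑y ∧ is_pair ↑↑p v1 v0).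

(** p = <x, y, z> = <x, <y, z>> *)
Definition is_triple {n} (p x y z : 'I_n) : form n :=
  ∃' (is_opair v0 ↑y ↑z ∧ is_opair ↑p ↑x v0).

(** <x, y> belongs to r *)
Definition opair_in {n} (x y r : 'I_n) : form n :=
  ∃∈ r, is_opair v0 ↑x ↑y.

Inductive fund_op : Type :=
| op_pair     (* {x, y} *)
| op_inter    (* x ∩ ⋂y *)
| op_union    (* ⋃x *)
| op_diff     (* x \ y *)
| op_prod     (* x × y *)
| op_imp      (* x ∩ {z : y is an ordered pair ∧ (z ∈ 1st(y) → z ∈ 2nd(y))} *)
| op_sections (* {{u : <z,u> ∈ x} : z ∈ y} *)
| op_dom      (* dom(x) *)
| op_ran      (* ran(x) *)
| op_uvw      (* {<u,v,w> : <u,v> ∈ x ∧ w ∈ y} *)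
| op_uwv      (* {<u,w,v> : <u,v> ∈ x ∧ w ∈ y} *)
| op_eq       (* {<v,u> ∈ y × x : u = v} *)
| op_mem.     (* {<v,u> ∈ y × x : u ∈ v} *)

(** The formula "e belongs to F(x, y)". In [op_inter], membership in
    ⋂y is the condition (∀w∈y) e∈w, also when y is empty. *)
Definition in_op {n} (F : fund_op) (e x y : 'I_n) : form n :=
  match F with
  | op_pair => e ≐ x ∨ e ≐ y
  | op_inter => e ∈ x ∧ (∀∈ y, ↑e ∈ v0)
  | op_union => ∃∈ x, ↑e ∈ v0
  | op_diff => e ∈ x ∧ ¬ e ∈ y
  | op_prod => ∃∈ x, ∃∈ ↑y, is_opair ↑↑e v1 v0
  | op_imp =>
      e ∈ x ∧ ∃' ∃' (is_opair ↑↑y v1 v0 ∧ (↑↑e ∈ v1 ⇒ ↑↑e ∈ v0))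
  | op_sections => ∃∈ y, ∀' (v0 ∈ ↑↑e ⇔ opair_in v1 v0 ↑↑x)
  | op_dom => ∃∈ x, ∃' is_opair v1 ↑↑e v0
  | op_ran => ∃∈ x, ∃' is_opair v1 v0 ↑↑e
  | op_uvw => (* u, v, w are [v2], [v1], [v0] *)
      ∃' ∃' ∃∈ ↑↑y, (opair_in v2 v1 ↑↑↑x ∧ is_triple ↑↑↑e v2 v1 v0)
  | op_uwv =>
      ∃' ∃' ∃∈ ↑↑y, (opair_in v2 v1 ↑↑↑x ∧ is_triple ↑↑↑e v2 v0 v1)
  | op_eq => (* v, u are [v1], [v0] *)
      ∃∈ y, ∃∈ ↑x, (is_opair ↑↑e v1 v0 ∧ v0 ≐ v1)
  | op_mem =>
      ∃∈ y, ∃∈ ↑x, (is_opair ↑↑e v1 v0 ∧ v0 ∈ v1)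
  end.

(** z = F(x, y) *)
Definition op_graph {n} (F : fund_op) (z x y : 'I_n) : form n :=
  ∀' (v0 ∈ ↑z ⇔ in_op F v0 ↑x ↑y).

(** Terms of [n] arguments built from the fundamental operations by
    composition. All operations are binary; the unary ones ignore their second
    argument. *)
Inductive op_term (n : nat) : Type :=
| tvar of 'I_n
| tapp of fund_op & op_term n & op_term n.

(** [term_graph t args z] is the formula z = t(args 0, ..., args (n-1)), a
    composite being read as F(s, t) = z iff (∃p)(∃q)(p = s ∧ q = t ∧ z = F(p, q)). *)
Fixpoint term_graph {n} (t : op_term n) {m} (args : 'I_n -> 'I_m) (z : 'I_m)
    : form m :=
  match t with
  | tvar j => z ≐ args j
  | tapp F s t =>
      ∃' ∃' (term_graph s (fun j => ↑↑(args j)) v1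
             ∧ term_graph t (fun j => ↑↑(args j)) v0
             ∧ op_graph F ↑↑z v1 v0)
  end.

(** The formula t(x_0, ..., x_(n-1)) = {x : A}, where x is variable 0 of [A]:
    there is a z which is the unique value of the term and whose elements are
    exactly the x satisfying [A]. *)
Definition term_eq_class {n} (t : op_term n) (A : form n.+1) : form n :=
  ∃' ((∀' (term_graph t (fun j => ↑↑j) v0 ⇔ v0 ≐ v1))
      ∧ (∀' (v0 ∈ v1 ⇔ ren (up shift) A))).

(* Main.v *)
Require Import Defs.
From Stdlib Require Import FunctionalExtensionality PropExtensionality ProofIrrelevance.
From mathcomp Require Import all_boot.
Set Implicit Arguments.
Unset Strict Implicit.
Unset Printing Implicit Defensive.
Local Open Scope set_formula_scope.

(** Represent an environment varying over a set S by its coordinate graphs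
    P_j = {<p_j(s), s> : s in S}. By induction on a Sigma_0 formula A, there is
    a term in S and the P_j with value {s in S : A(p_0(s), p_1(s), ...)}:
    - x_i = x_j gives ran(P_i ∩ P_j), and x_i in x_j gives
      ran(P_i ∩ ran({<v,u,s> : <v,s> in P_j} ∩ {<v,u,s> : u in v}));
    - implication is the operation [op_imp] applied to an ordered pair;
    - for a quantifier bounded by x_b, put Y = U dom(P_b), replace S by Y x S,
      P_j by {<v,y,s> : <v,s> in P_j}, and add {<y,y,s>} as new coordinate; the
      existential quantifier is then ran, and the universal one is S ∩ ⋂ of the
      sections over Y.
    The theorem is the case S = a, P_i = {<x,x> : x in a}, P_j = {x_j} x a.

    Provability is handled through a sound and complete interpretation of
    formulas as local predicates over sequents, with the constant domain [nat]
    of variables: disjunction and existence hold at a sequent when everything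
    they are known to imply is provable from it. *)

(** * Renaming *)

Lemma insert_ord0 (A : Type) n a (f : 'I_n -> A) : insert ord0 a f ord0 = a.
Proof. by rewrite /insert unlift_none. Qed.

Lemma insert_shift (A : Type) n a (f : 'I_n -> A) i : insert ord0 a f (↑i) = f i.
Proof. by rewrite /insert /shift liftK. Qed.

Lemma ord_shiftP n (P : 'I_n.+1 -> Prop) : P ord0 -> (forall i, P (↑i)) -> forall i, P i.
Proof. by move=> P0 PS i; case: (unliftP ord0 i) => [j|] ->; [exact: PS|]. Qed.

Lemma up_v0 m n (f : 'I_m -> 'I_n) : up f v0 = v0.
Proof. exact: insert_ord0. Qed.

Lemma up_shift m n (f : 'I_m -> 'I_n) i : up f (↑i) = ↑(f i).
Proof. exact: insert_shift. Qed.

Lemma up_comp m n p (g : 'I_n -> 'I_p) (f : 'I_m -> 'I_n) : up g \o up f =1 up (g \o f).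
Proof. by apply: ord_shiftP => [|i] /=; rewrite ?up_v0 // !up_shift. Qed.

Lemma eq_up m n (f g : 'I_m -> 'I_n) : f =1 g -> up f =1 up g.
Proof. by move=> fg; apply: ord_shiftP => [|i]; rewrite ?up_v0 // !up_shift fg. Qed.

Lemma up_id n : up (@id 'I_n) =1 id.
Proof. by apply: ord_shiftP => [|i]; rewrite ?up_v0 // !up_shift. Qed.

Lemma eq_ren m n (A : form m) (f g : 'I_m -> 'I_n) : f =1 g -> ren f A = ren g A.
Proof.
elim: A n f g => //= {m} [m x y|m x y|m A IA B IB|m A IA B IB|m A IA B IB|m A IA|m A IA] n f g fg;
  rewrite ?fg ?(IA _ _ _ fg) ?(IB _ _ _ fg) //; by rewrite (IA _ _ _ (eq_up fg)).
Qed.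

Lemma ren_comp m n p (A : form m) (f : 'I_m -> 'I_n) (g : 'I_n -> 'I_p) :
  ren g (ren f A) = ren (g \o f) A.
Proof.
elim: A n p f g => //= {m} [m A IA B IB|m A IA B IB|m A IA B IB|m A IA|m A IA] n p f g;
  rewrite IA ?IB //; congr (_ _); exact/eq_ren/up_comp.
Qed.

Lemma ren_id n (A : form n) f : f =1 id -> ren f A = A.
Proof.
elim: A f => //= {n} [n x y|n x y|n A IA B IB|n A IA B IB|n A IA B IB|n A IA|n A IA] f fid;
  rewrite ?fid ?IA ?IB //;
  by move=> i; rewrite (eq_up fid) up_id.
Qed.

Lemma ren_inst m n (f : 'I_m -> 'I_n) y A : ren f (inst y A) = inst (f y) (ren (up f) A).
Proof.
rewrite /inst !ren_comp; apply: eq_ren.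
by apply: ord_shiftP => [|i] /=; rewrite ?up_v0 ?up_shift ?insert_ord0 ?insert_shift.
Qed.

Lemma ren_up_shift m n (f : 'I_m -> 'I_n) A : ren (up f) (ren shift A) = ren shift (ren f A).
Proof. by rewrite !ren_comp; apply: eq_ren => i /=; rewrite up_shift. Qed.

Lemma ren_up_up_shift m n (f : 'I_m -> 'I_n) (A : form m.+1) :
  ren (up (up f)) (ren (up shift) A) = ren (up shift) (ren (up f) A).
Proof.
rewrite !ren_comp; apply: eq_ren.
by apply: ord_shiftP => [|i] /=; rewrite ?up_v0 ?up_shift ?up_v0 ?up_shift.
Qed.

Lemma ren_up_up_up_shift m n (f : 'I_m -> 'I_n) (A : form m.+2) :
  ren (up (up (up f))) (ren (up (up shift)) A) = ren (up (up shift)) (ren (up (up f)) A).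
Proof.
rewrite !ren_comp; apply: eq_ren; apply: ord_shiftP => [|i] /=; first by rewrite !up_v0.
by move: i; apply: ord_shiftP => [|i] /=; rewrite !(up_v0, up_shift).
Qed.

Lemma Sigma0_ren m n (A : form m) (f : 'I_m -> 'I_n) : Sigma0 A -> Sigma0 (ren f A).
Proof.
move=> S; elim: S n f => {m A} /=; try by move=> *; constructor; auto.
- by move=> m y A _ IA n f; rewrite up_v0 up_shift; constructor; auto.
- by move=> m y A _ IA n f; rewrite up_v0 up_shift; constructor; auto.
Qed.

(** Each scheme is closed under renaming its parameters: [up] fixes the bound variables of the
    axiom, and [Sigma0] is preserved in the two restricted schemes. *)
Lemma IKP_ren m n (A : form m) (f : 'I_m -> 'I_n) :
  IKP_minus_Inf A -> IKP_minus_Inf (ren f A).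
Proof.
move=> axA; case: m A / axA f => /=.
- move=> m f; rewrite /v2 /v1 !(up_v0, up_shift); exact: ax_extensionality.
- move=> m f; rewrite /v2 /v1 !(up_v0, up_shift); exact: ax_empty.
- move=> m x y f; rewrite /v2 /v1 !(up_v0, up_shift); exact: ax_pairing.
- move=> m x f; rewrite /v2 /v1 !(up_v0, up_shift); exact: ax_union.
- move=> m A f; rewrite /v2 /v1 !(up_v0, up_shift) ren_up_up_shift; exact: ax_set_induction.
- move=> m a A SA f; rewrite /v2 /v1 !(up_v0, up_shift) ren_up_up_shift.
  exact/ax_Sigma0_separation/Sigma0_ren.
- move=> m a A SA f; rewrite /v2 /v1 !(up_v0, up_shift) ren_up_up_up_shift.
  exact/ax_Sigma0_collection/Sigma0_ren.
Qed.

(** * Derivations under renaming and weakening *)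

Lemma In_map (A B : Type) (f : A -> B) x s : List.In x s -> List.In (f x) (map f s).
Proof. by elim: s => //= y s IH [->|/IH]; [left|right]. Qed.

Lemma In_mapE (A B : Type) (f : A -> B) y s :
  List.In y (map f s) -> exists2 x, List.In x s & y = f x.
Proof.
elim: s => //= z s IH [<-|/IH[x xs ->]]; first by exists z; [left|].
by exists x; [right|].
Qed.

Lemma incl_cons2 (A : Type) (x : A) s t : List.incl s t -> List.incl (x :: s) (x :: t).
Proof. by move=> st y; case=> [<-|ys]; [left|right; apply: st]. Qed.

Lemma incl_map (A B : Type) (f : A -> B) s t : List.incl s t -> List.incl (map f s) (map f t).
Proof. by move=> st y ys; have [x xs ->] := In_mapE ys; apply/In_map/st. Qed.

Lemma map_ren_shift m n (f : 'I_m -> 'I_n) G :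
  map (ren (up f)) (map (ren shift) G) = map (ren shift) (map (ren f) G).
Proof. by rewrite -!map_comp; apply: eq_map => A /=; rewrite ren_up_shift. Qed.

(** Renaming and weakening are proved together, with [f] and [G'] general, so that the induction
    passes below quantifiers through [up f]. No injectivity is required of [f]; [unfresh] and
    [sem_complete] rename along maps that identify variables. *)
Lemma proves_ren m n (G : seq (form m)) A (f : 'I_m -> 'I_n) G' :
  proves IKP_minus_Inf G A -> List.incl (map (ren f) G) G' ->
  proves IKP_minus_Inf G' (ren f A).
Proof.
move=> pA; elim: pA n f G' => {m G A} /=.
- by move=> m G A axA n f G' _; apply/prAx/IKP_ren.
- by move=> m G A inA n f G' sG; apply/prHyp/sG/In_map.
- by move=> m G A _ IA n f G' sG; apply: prBotE; apply: IA sG.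
- by move=> m G A B _ IA _ IB n f G' sG; apply: prAndI; [apply: IA|apply: IB].
- by move=> m G A B _ IA n f G' sG; apply: prAndE1; apply: IA sG.
- by move=> m G A B _ IA n f G' sG; apply: prAndE2; apply: IA sG.
- by move=> m G A B _ IA n f G' sG; apply: prOrI1; apply: IA sG.
- by move=> m G A B _ IA n f G' sG; apply: prOrI2; apply: IA sG.
- move=> m G A B C _ IA _ IB _ IC n f G' sG.
  by apply: prOrE; [apply: IA sG|apply: IB|apply: IC]; apply: incl_cons2.
- by move=> m G A B _ IA n f G' sG; apply: prImpI; apply: IA; apply: incl_cons2.
- by move=> m G A B _ IA _ IB n f G' sG; apply: prImpE; [apply: IA sG|apply: IB].
- move=> m G A _ IA n f G' sG; apply: prAllI; apply: IA.
  by rewrite map_ren_shift; apply: incl_map.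
- by move=> m G A y _ IA n f G' sG; rewrite ren_inst; apply: prAllE; apply: IA sG.
- move=> m G A y _ IA n f G' sG; apply: (prExI (y := f y)).
  by rewrite -ren_inst; apply: IA.
- move=> m G A B _ IA _ IB n f G' sG; apply: prExE; first exact: IA sG.
  rewrite -ren_up_shift; apply: IB => /=; apply: incl_cons2.
  by rewrite map_ren_shift; apply: incl_map.
- by move=> m G x n f G' _; apply: prEqI.
- move=> m G A x y _ IE _ IA n f G' sG; rewrite ren_inst.
  by apply: prEqE; [apply: IE sG|rewrite -ren_inst; apply: IA].
Qed.

Lemma proves_weak n (G G' : seq (form n)) A :
  List.incl G G' -> proves IKP_minus_Inf G A -> proves IKP_minus_Inf G' A.
Proof.
move=> sG pA; rewrite -(@ren_id _ A id) //; apply: (proves_ren pA).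
by move=> B BG; have [C CG ->] := In_mapE BG; rewrite ren_id //; apply: sG.
Qed.

(** * Truth values *)

(* Environments are functions on [nat], not on ['I_n], so that the value of a
   shifted variable in an extended environment is computed by conversion. *)
Definition cons_env (x : nat) (r : nat -> nat) (k : nat) : nat :=
  if k is k'.+1 then r k' else x.

Notation "x ;; r" := (cons_env x r) (at level 60, right associativity).

Record nform := NForm { ar : nat; body : form ar; env : nat -> nat }.

(* Meaningful when all parameters are at most M, since [inord] sends larger ones to 0;
   hence only large M count in [entails]. *)
Definition at_ctx M (F : nform) : form M.+1 := ren (fun i => inord (env F i)) (body F).

Definition world := seq nform.

Definition entails (w : world) (F : nform) :=
  exists M0, forall M, M0 <= M -> proves IKP_minus_Inf (map (at_ctx M) w) (at_ctx M F).

Definition bound (F : nform) := \max_(i < ar F) env F i.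

Definition wbound (w : world) := foldr (fun F => maxn (bound F)) 0 w.

Lemma env_bound F (i : 'I_(ar F)) : env F i <= bound F.
Proof. exact: leq_bigmax. Qed.

(* Turns the fresh parameter [x] into the variable bound by an added quantifier. *)
Definition unfresh N M x (j : 'I_N.+1) : 'I_M.+2 := if j == x :> nat then v0 else ↑(inord j).

Lemma ren_unfresh N M x F :
  bound F < x -> x <= N -> ren (@unfresh N M x) (at_ctx N F) = ren shift (at_ctx M F).
Proof.
move=> Fx xN; rewrite !ren_comp; apply: eq_ren => i /=.
have lt_x := leq_ltn_trans (env_bound i) Fx.
by rewrite /unfresh inordK ?(ltn_eqF lt_x) //; apply: leq_trans lt_x (leqW xN).
Qed.

Lemma map_unfresh N M x w :
  wbound w < x -> x <= N ->
  map (ren (@unfresh N M x)) (map (at_ctx N) w) = map (ren shift) (map (at_ctx M) w).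
Proof.
move=> wx xN; elim: w wx => //= F w IH; rewrite gtn_max => /andP[Fx wx].
by rewrite ren_unfresh // IH.
Qed.

Lemma ren_unfresh_cons N M x n (A : form n.+1) r :
  bound (NForm (∀' A) r) < x -> x <= N ->
  ren (@unfresh N M x) (at_ctx N (NForm A (x ;; r))) = ren (up (fun i => inord (r i))) A.
Proof.
move=> Fx xN; rewrite ren_comp; apply: eq_ren; apply: ord_shiftP => [|i] /=.
  by rewrite /unfresh inordK ?ltnS // eqxx up_v0.
have lt_x : r i < x := leq_ltn_trans (env_bound (F := NForm (∀' A) r) i) Fx.
by rewrite up_shift /unfresh inordK ?(ltn_eqF lt_x) //; apply: leq_trans lt_x (leqW xN).
Qed.

Lemma at_ctx_inst M n (A : form n.+1) x r :
  at_ctx M (NForm A (x ;; r)) = inst (inord x) (ren (up (fun i : 'I_n => inord (r i))) A).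
Proof.
rewrite /inst ren_comp; apply: eq_ren; apply: ord_shiftP => [|i] /=.
  by rewrite up_v0 insert_ord0.
by rewrite up_shift insert_shift.
Qed.

(** One instance of the infinitely many premises is enough, namely one at a fresh parameter. Its
    derivation, possibly in a larger context, is carried by [unfresh] to the premise of the
    quantifier rule in context [M]. *)
Lemma entails_all n (A : form n.+1) r w :
  (forall x, entails w (NForm A (x ;; r))) -> entails w (NForm (∀' A) r).
Proof.
(* This parameter exceeds every parameter of [w] and of the quantified formula, hence is fresh. *)
pose x := (maxn (wbound w) (bound (NForm (∀' A) r))).+1.
case/(_ x) => M0 pA; exists 0 => M _; apply: prAllI.
have := pA (maxn M0 x) (leq_maxl _ _) => {}pA.
rewrite -[X in proves _ _ X]/(ren (up (fun i : 'I_n => inord (r i))) A).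
rewrite -(@ren_unfresh_cons (maxn M0 x) M x n A r) ?ltnS ?leq_maxr //.
by apply: (proves_ren pA); rewrite map_unfresh ?ltnS ?leq_maxl ?leq_maxr.
Qed.

Lemma entails_exE n (A : form n.+1) r w F :
  entails w (NForm (∃' A) r) ->
  (forall x, entails (NForm A (x ;; r) :: w) F) -> entails w F.
Proof.
(* [bound] depends only on the arity and the environment, so [∀' A] may stand for [∃' A] here, which
   is the form used in [ren_unfresh_cons]. *)
pose x := (maxn (maxn (wbound w) (bound F)) (bound (NForm (∀' A) r))).+1.
case=> M1 pE /(_ x)[M0 pF]; exists M1 => M M1M; apply: prExE; first exact: pE M1M.
have := pF (maxn M0 x) (leq_maxl _ _) => {}pF.
rewrite -(@ren_unfresh (maxn M0 x) M x) ?ltnS ?leq_maxr //; last first.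
  by rewrite leq_max leq_maxr.
apply: (proves_ren pF) => /=.
rewrite map_unfresh ?ltnS ?leq_maxr //; last by rewrite leq_max leq_maxl.
by rewrite ren_unfresh_cons ?ltnS ?leq_maxr.
Qed.

Lemma entails_weak w w' F : List.incl w w' -> entails w F -> entails w' F.
Proof.
move=> sw [M0 pF]; exists M0 => M M0M; apply: proves_weak (pF M M0M).
exact: incl_map.
Qed.

Lemma entails_rule1 w F G :
  (forall M, proves IKP_minus_Inf (map (at_ctx M) w) (at_ctx M F) ->
     proves IKP_minus_Inf (map (at_ctx M) w) (at_ctx M G)) ->
  entails w F -> entails w G.
Proof. by move=> FG [M0 pF]; exists M0 => M /pF; apply: FG. Qed.

Lemma entails_rule2 w F1 F2 G :
  (forall M, proves IKP_minus_Inf (map (at_ctx M) w) (at_ctx M F1) ->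
     proves IKP_minus_Inf (map (at_ctx M) w) (at_ctx M F2) ->
     proves IKP_minus_Inf (map (at_ctx M) w) (at_ctx M G)) ->
  entails w F1 -> entails w F2 -> entails w G.
Proof.
move=> FG [M1 pF1] [M2 pF2]; exists (maxn M1 M2) => M.
by rewrite geq_max => /andP[/pF1 h1 /pF2 h2]; apply: FG.
Qed.

Lemma entails_imp n (A B : form n) r w :
  entails (NForm A r :: w) (NForm B r) -> entails w (NForm (A ⇒ B) r).
Proof. by case=> M0 pB; exists M0 => M /pB; apply: prImpI. Qed.

Lemma entails_orE n (A B : form n) r w F :
  entails w (NForm (A ∨ B) r) -> entails (NForm A r :: w) F ->
  entails (NForm B r :: w) F -> entails w F.
Proof.
move=> [M0 pO] [M1 pA] [M2 pB]; exists (maxn M0 (maxn M1 M2)) => M.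
rewrite !geq_max => /and3P[h0 h1 h2].
by apply: prOrE (pO _ h0) _ _; [exact: pA|exact: pB].
Qed.

Lemma entails_hyp w F : List.In F w -> entails w F.
Proof. by move=> Fw; exists 0 => M _; apply/prHyp/In_map. Qed.

(* [force_local] makes the elimination rules of disjunction and existence
   available for every truth value and not just for formulas. *)
Record Om := MkOm {
  force :> world -> Prop;
  force_mono : forall w w', List.incl w w' -> force w -> force w';
  force_local : forall w,
    (forall w' F, List.incl w w' ->
       (forall v, List.incl w' v -> force v -> entails v F) -> entails w' F) ->
    force w }.

(** Equivalent truth values become equal by the extensionality axioms of the metatheory. Hence
    equivalences can be used for rewriting inside larger truth values. *)
Lemma Om_ext (P Q : Om) : (forall w, P w <-> Q w) -> P = Q.
Proof.
case: P Q => [P Pm Pl] [Q Qm Ql] /= PQ.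
have E : P = Q by apply: functional_extensionality => w; apply/propositional_extensionality/PQ.
by subst Q; congr MkOm; apply: proof_irrelevance.
Qed.

#[local] Obligation Tactic := idtac.

Program Definition Prv F : Om := @MkOm (fun w => entails w F) _ _.
Next Obligation. by move=> F w w'; apply: entails_weak. Qed.
Next Obligation. by move=> F w h; apply: (h w F); [move=> A|move=> v _]. Qed.

Program Definition And (P Q : Om) : Om := @MkOm (fun w => P w /\ Q w) _ _.
Next Obligation. by move=> P Q w w' i [p q]; split; [apply: force_mono p|apply: force_mono q]. Qed.
Next Obligation.
by move=> P Q w h; split; apply: force_local => w' F i pF;
  apply: (h w' F i) => v j [p q]; apply: pF.
Qed.

Program Definition Imp (P Q : Om) : Om :=
  @MkOm (fun w => forall w', List.incl w w' -> P w' -> Q w') _ _.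
Next Obligation.
by move=> P Q w w' i h v j; apply: h; apply: List.incl_tran j.
Qed.
Next Obligation.
move=> P Q w h v i p; apply: force_local => w' F j QF.
apply: (h w' F) => [|u k PQ]; first exact: List.incl_tran j.
apply: QF (k) _; apply: PQ; first by move=> a.
by apply: force_mono p; apply: List.incl_tran k.
Qed.

Program Definition All (I : Type) (P : I -> Om) : Om := @MkOm (fun w => forall x, P x w) _ _.
Next Obligation. by move=> I P w w' i h x; apply: force_mono (h x). Qed.
Next Obligation.
move=> I P w h x; apply: force_local => w' F i PF.
by apply: (h w' F i) => v j Pv; apply: PF.
Qed.

(** Closure of [U] under the rule of [force_local]. A union of truth values is monotone but need not
    satisfy that rule, so disjunction and existence are obtained by closing it. *)
Program Definition Sup (U : world -> Prop) : Om :=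
  @MkOm (fun w => forall w' F, List.incl w w' ->
       (forall v, List.incl w' v -> U v -> entails v F) -> entails w' F) _ _.
Next Obligation. by move=> U w w' i h v F j; apply: h; apply: List.incl_tran j. Qed.
Next Obligation.
move=> U w h w' F i UF; apply: h => // v j; apply; first by move=> a.
by move=> u k; apply: UF; apply: List.incl_tran k.
Qed.

Definition Or (P Q : Om) := Sup (fun w => P w \/ Q w).
Definition Ex (P : nat -> Om) := Sup (fun w => exists x, P x w).

Lemma Sup_elim U (Q : Om) w :
  Sup U w -> (forall w', List.incl w w' -> U w' -> Q w') -> Q w.
Proof.
move=> h UQ; apply: force_local => w' F i QF; apply: h => // v j Uv.
by apply: QF => //; apply: UQ => //; apply: List.incl_tran j.
Qed.

Lemma exE (P : nat -> Om) (Q : Om) w :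
  Ex P w -> (forall w', List.incl w w' -> forall x, P x w' -> Q w') -> Q w.
Proof. by move=> h PQ; apply: (Sup_elim h) => w' i [x]; apply: PQ. Qed.

Lemma orE (P1 P2 Q : Om) w :
  Or P1 P2 w -> (forall w', List.incl w w' -> P1 w' -> Q w') ->
  (forall w', List.incl w w' -> P2 w' -> Q w') -> Q w.
Proof. by move=> h Q1 Q2; apply: (Sup_elim h) => w' i []; [apply: Q1|apply: Q2]. Qed.

Lemma exI (P : nat -> Om) x w : P x w -> Ex P w.
Proof.
move=> p w' F i; apply; first by move=> a.
by exists x; apply: force_mono p.
Qed.

Lemma orI1 (P Q : Om) w : P w -> Or P Q w.
Proof.
move=> p w' F i; apply; first by move=> a.
by left; apply: force_mono p.
Qed.

Lemma orI2 (P Q : Om) w : Q w -> Or P Q w.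
Proof.
move=> p w' F i; apply; first by move=> a.
by right; apply: force_mono p.
Qed.

Lemma mp (P Q : Om) w : Imp P Q w -> P w -> Q w.
Proof. by apply=> a. Qed.

(** * Interpretation of formulas; soundness and completeness *)

Definition Bot : Om := Prv (NForm (⊥ : form 0) id).
Definition Elem x y : Om := Prv (NForm (v0 ∈ v1 : form 2) (x ;; y ;; id)).
Definition Equal x y : Om := Prv (NForm (v0 ≐ v1 : form 2) (x ;; y ;; id)).

Lemma botE (P : Om) w : Bot w -> P w.
Proof.
move=> b; apply: force_local => w' F i _.
by move: (entails_weak i b); apply: entails_rule1 => M; apply: prBotE.
Qed.

Fixpoint sem n (A : form n) (r : nat -> nat) : Om :=
  match A with
  | fbot => Bot
  | fmem x y => Elem (r x) (r y)
  | feq x y => Equal (r x) (r y)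
  | fand A B => And (sem A r) (sem B r)
  | for_ A B => Or (sem A r) (sem B r)
  | fimp A B => Imp (sem A r) (sem B r)
  | fall A => All (fun x => sem A (x ;; r))
  | fex A => Ex (fun x => sem A (x ;; r))
  end.

Lemma cons_env_up m n (f : 'I_m -> 'I_n) (r r' : nat -> nat) x :
  (forall i : 'I_m, r' i = r (f i)) -> forall i : 'I_m.+1, (x ;; r') i = (x ;; r) (up f i).
Proof.
move=> E; apply: ord_shiftP => [|i]; first by rewrite up_v0.
by rewrite up_shift; apply: E.
Qed.

Lemma sem_ren m n (A : form m) (f : 'I_m -> 'I_n) (r r' : nat -> nat) :
  (forall i : 'I_m, r' i = r (f i)) -> sem (ren f A) r = sem A r'.
Proof.
elim: A n f r r' => {m} /=.
- by [].
- by move=> m x y n f r r' E; rewrite !E.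
- by move=> m x y n f r r' E; rewrite !E.
- by move=> m A IA B IB n f r r' E; rewrite (IA _ _ _ r') ?(IB _ _ _ r').
- by move=> m A IA B IB n f r r' E; rewrite (IA _ _ _ r') ?(IB _ _ _ r').
- by move=> m A IA B IB n f r r' E; rewrite (IA _ _ _ r') ?(IB _ _ _ r').
- move=> m A IA n f r r' E; congr All; apply: functional_extensionality => x.
  exact/IA/cons_env_up.
- move=> m A IA n f r r' E; congr Ex; apply: functional_extensionality => x.
  exact/IA/cons_env_up.
Qed.

(** Truth is provability. For disjunction and existence, one direction instantiates the target
    formula of [Sup] with the formula itself, and the other is the elimination rule. Truth of an
    implication is tested at the world extended by its antecedent. *)
Lemma semP n (A : form n) r w : sem A r w <-> entails w (NForm A r).
Proof.
have inc : forall w, List.incl w w by move=> ? ?.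
have incl_cons F v : List.incl v (F :: v) by move=> ? ?; right.
elim: A r w => {n} /=.
- by move=> n r w.
- by move=> n x y r w; split; apply: entails_rule1 => M.
- by move=> n x y r w; split; apply: entails_rule1 => M.
- move=> n A IA B IB r w; split=> [[/IA a /IB b]|ab].
    by move: a b; apply: entails_rule2 => M; apply: prAndI.
  by split; [apply/IA|apply/IB]; move: ab; apply: entails_rule1 => M;
    [apply: prAndE1|apply: prAndE2].
- move=> n A IA B IB r w; split=> [h|h].
    apply: h => // v _ [/IA|/IB]; apply: entails_rule1 => M; [exact: prOrI1|exact: prOrI2].
  move=> v F i ABF; apply: (entails_orE (entails_weak i h)).
    by apply: ABF => //; left; apply/IA/entails_hyp; left.
  by apply: ABF => //; right; apply/IB/entails_hyp; left.
- move=> n A IA B IB r w; split=> [h|h].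
    apply: entails_imp; apply/IB/h => //; apply/IA/entails_hyp; by left.
  move=> v i /IA a; apply/IB; move: (entails_weak i h) a.
  by apply: entails_rule2 => M; apply: prImpE.
- move=> n A IA r w; split=> [h|h x]; first by apply: entails_all => x; apply/IA.
  apply/IA; move: h; apply: entails_rule1 => M h.
  by rewrite at_ctx_inst; apply: prAllE.
- move=> n A IA r w; split=> [h|h].
    apply: h => // v _ [x /IA]; apply: entails_rule1 => M.
    by rewrite at_ctx_inst; apply: prExI.
  move=> v F i AF; apply: (entails_exE (entails_weak i h)) => x.
  by apply: AF => //; exists x; apply/IA/entails_hyp; left.
Qed.

Lemma sem_axiom n (A : form n) r w : IKP_minus_Inf A -> sem A r w.
Proof. by move=> axA; apply/semP; exists 0 => M _; apply/prAx/IKP_ren. Qed.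

(** The environment [id] and a context with [M] at least [n] keep the variables of [A] distinct, so
    renaming back along [inord] restores [A]. *)
Lemma sem_complete n (A : form n.+1) :
  (forall r, sem A r [::]) -> IKP_minus_Inf ⊢ A.
Proof.
move=> /(_ id)/semP[M0 /(_ (maxn M0 n) (leq_maxl _ _)) pA].
have := proves_ren (f := fun j => inord j : 'I_n.+1) (G' := [::]) pA.
rewrite /at_ctx ren_comp ren_id; first by apply=> ?.
move=> i /=; rewrite inordK ?inord_val // ltnS leq_max.
by rewrite -(ltnS i n) ltn_ord orbT.
Qed.

(** The congruence rules below are instances at formulas in which the replaced place is variable
    0. *)
Lemma eq_subst n (A : form n.+1) r a b w :
  Equal a b w -> sem A (a ;; r) w -> sem A (b ;; r) w.
Proof.
move=> ab /semP Aa; apply/semP; move: ab Aa; apply: entails_rule2 => M.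
move=> ab; rewrite (at_ctx_inst _ A a) (at_ctx_inst _ A b); exact: prEqE ab.
Qed.

Lemma equal_refl a w : Equal a a w.
Proof. by exists 0 => M _; exact: prEqI. Qed.

(** * Pairs and extensions *)

(** Transports every fact forced at the old world to the larger one and, where possible, reuses the
    old name. With it, [iintro], [iex] and [ior] make proofs inside truth values read like natural
    deduction. *)
Ltac advance i :=
  match type of i with List.incl ?w ?w' =>
    repeat match goal with H : force _ w |- _ => apply (force_mono i) in H end;
    clear i; try (clear w; rename w' into w)
  end.

Tactic Notation "iintro" simple_intropattern(H) :=
  let w := fresh "w" in let i := fresh "i" in let h := fresh "h" in
  intros w i h; advance i; revert h; intros H.

Tactic Notation "iex" open_constr(H) "as" ident(x) simple_intropattern(Hx) :=
  let w := fresh "w" in let i := fresh "i" in let h := fresh "h" in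
  refine (exE H _); try clear H; intros w i x h; advance i; revert h; intros Hx.

Tactic Notation "ior" open_constr(H) "as" simple_intropattern(H1) "|" simple_intropattern(H2) :=
  let w := fresh "w" in let i := fresh "i" in let h := fresh "h" in
  refine (orE H _ _); try clear H; intros w i h; advance i; revert h; [intros H1|intros H2].

Definition Iff P Q := And (Imp P Q) (Imp Q P).
Definition BEx d (P : nat -> Om) := Ex (fun x => And (Elem x d) (P x)).
Definition BAll d (P : nat -> Om) := All (fun x => Imp (Elem x d) (P x)).
Definition Ext (P : nat -> Om) z := All (fun x => Iff (Elem x z) (P x)).
Definition Pair p x y := Ext (fun z => Or (Equal z x) (Equal z y)) p.
Definition Opair p x y :=
  Ex (fun a => Ex (fun b => And (Pair a x x) (And (Pair b x y) (Pair p a b)))).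

Lemma IffP P Q w : Iff P Q w -> (P w <-> Q w).
Proof. by case=> pq qp; split; apply: mp. Qed.

Lemma iff_of (P Q : Om) w : (forall w, P w <-> Q w) -> Iff P Q w.
Proof. by move=> PQ; split; iintro H; apply/PQ. Qed.

Lemma extP (P : nat -> Om) z x w : Ext P z w -> (Elem x z w <-> P x w).
Proof. by move=> E; apply/IffP/E. Qed.

Lemma bexI d (P : nat -> Om) x w : Elem x d w -> P x w -> BEx d P w.
Proof. by move=> xd Px; apply: (exI (x := x)). Qed.

Lemma ballE d (P : nat -> Om) x w : BAll d P w -> Elem x d w -> P x w.
Proof. by move=> h; apply/mp/h. Qed.

Lemma eq_of_ext a b w : All (fun e => Iff (Elem e a) (Elem e b)) w -> Equal a b w.
Proof.
move=> E; apply: (mp (P := All (fun e => Iff (Elem e a) (Elem e b)))) E.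
(* The outer quantifier of the axiom is the right-hand side of the equation, hence the order
   [b a]. *)
exact: (sem_axiom id w (ax_extensionality 0) b a).
Qed.

Lemma equal_sym a b w : Equal a b w -> Equal b a w.
Proof.
by move=> ab; apply: (@eq_subst 1 (v0 ≐ v1) (a ;; id) a b w ab); apply: equal_refl.
Qed.

Lemma equal_trans a b c w : Equal a b w -> Equal b c w -> Equal a c w.
Proof. by move=> ab bc; apply: (@eq_subst 1 (v1 ≐ v0) (a ;; id) b c w bc). Qed.

Lemma mem_l a b c w : Equal a b w -> Elem a c w -> Elem b c w.
Proof. exact: (@eq_subst 1 (v0 ∈ v1) (c ;; id)). Qed.

Lemma mem_r a b c w : Equal a b w -> Elem c a w -> Elem c b w.
Proof. exact: (@eq_subst 1 (v1 ∈ v0) (c ;; id)). Qed.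

Ltac ieq := solve [eauto 6 using equal_sym, equal_trans, equal_refl].

Lemma ext_unique P a b w : Ext P a w -> Ext P b w -> Equal a b w.
Proof.
move=> Pa Pb; apply: eq_of_ext => e; split; iintro H.
  by apply/(extP e Pb)/(extP e Pa).
by apply/(extP e Pa)/(extP e Pb).
Qed.

Lemma pair_l p x y w : Pair p x y w -> Elem x p w.
Proof. by move=> h; apply/(extP x h)/orI1/equal_refl. Qed.

Lemma pair_r p x y w : Pair p x y w -> Elem y p w.
Proof. by move=> h; apply/(extP y h)/orI2/equal_refl. Qed.

Lemma singleP p x z w : Pair p x x w -> Elem z p w -> Equal z x w.
Proof. by move=> h /(extP z h) H; ior H as H|H. Qed.

Lemma pair_congr p x x' y y' w :
  Equal x x' w -> Equal y y' w -> Pair p x y w -> Pair p x' y' w.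
Proof.
move=> ex ey h.
have := @eq_subst 2 (is_pair v1 v0 v2) (p ;; y ;; id) x x' w ex h.
exact: (@eq_subst 2 (is_pair v1 v2 v0) (p ;; x' ;; id) y y' w ey).
Qed.

Lemma opair_congr p p' x x' y y' w :
  Equal p p' w -> Equal x x' w -> Equal y y' w -> Opair p x y w -> Opair p' x' y' w.
Proof.
move=> ep ex ey h.
have {}h := @eq_subst 2 (is_opair v0 v1 v2) (x ;; y ;; id) p p' w ep h.
have {}h := @eq_subst 2 (is_opair v1 v0 v2) (p' ;; y ;; id) x x' w ex h.
exact: (@eq_subst 2 (is_opair v1 v2 v0) (p' ;; x' ;; id) y y' w ey).
Qed.

Lemma opair_unique p q x y w : Opair p x y w -> Opair q x y w -> Equal p q w.
Proof.
move=> hp hq; iex hp as a hp; iex hp as b [ha [hb hp]].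
iex hq as a' hq; iex hq as b' [ha' [hb' hq]].
have ea := ext_unique ha' ha; have eb := ext_unique hb' hb.
exact: ext_unique hp (pair_congr ea eb hq).
Qed.

Lemma opair_inj1 p x y x' y' w : Opair p x y w -> Opair p x' y' w -> Equal x x' w.
Proof.
move=> hp hq; iex hp as a hp; iex hp as b [ha [hb hp]].
iex hq as a' hq; iex hq as b' [ha' [hb' hq]].
have H : Or (Equal a a') (Equal a b') w by apply/(extP a hq)/pair_l/hp.
ior H as H|H; apply/equal_sym/(singleP ha)/(mem_r (equal_sym H)).
  exact: pair_l ha'.
exact: pair_l hb'.
Qed.

(** The cases come from memberships in unordered pairs and not from deciding whether x = y, so the
    argument is intuitionistic. If {x,y} = {x'}, then y = x' = x and y' is x or x'; otherwise {x,y}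
    = {x',y'}. *)
Lemma opair_inj2 p x y x' y' w : Opair p x y w -> Opair p x' y' w -> Equal y y' w.
Proof.
move=> hp hq; have ex := opair_inj1 hp hq.
iex hp as a hp; iex hp as b [ha [hb hp]].
iex hq as a' hq; iex hq as b' [ha' [hb' hq]].
have H : Or (Equal b a') (Equal b b') w by apply/(extP b hq)/pair_r/hp.
ior H as H|H.
  have yx : Equal y x' w by apply/(singleP ha')/(mem_r H)/pair_r/hb.
  have H' : Or (Equal b' a) (Equal b' b) w by apply/(extP b' hp)/pair_r/hq.
  ior H' as H'|H'.
    have : Equal y' x w by apply/(singleP ha)/(mem_r H')/pair_r/hb'.
    by move=> ?; ieq.
  have : Equal y' x' w by apply/(singleP ha')/(mem_r H)/(mem_r H')/pair_r/hb'.
  by move=> ?; ieq.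
have H1 : Or (Equal y x') (Equal y y') w by apply/(extP y hb')/(mem_r H)/pair_r/hb.
ior H1 as H1|H1; last by [].
have H2 : Or (Equal y' x) (Equal y' y) w by apply/(extP y' hb)/(mem_r (equal_sym H))/pair_r/hb'.
by ior H2 as H2|H2; ieq.
Qed.

Lemma pair_ex x y w : Ex (fun p => Pair p x y) w.
Proof. exact: (sem_axiom (x ;; y ;; id) w (@ax_pairing 2 v0 v1)). Qed.

Arguments pair_ex : clear implicits.

Lemma opair_ex x y w : Ex (fun p => Opair p x y) w.
Proof.
iex (pair_ex x x w) as a ha; iex (pair_ex x y w) as b hb; iex (pair_ex a b w) as p hp.
by apply: (exI (x := p)); apply: (exI (x := a)); apply: (exI (x := b)).
Qed.

Arguments opair_ex : clear implicits.

Lemma union_ex a w : Ex (Ext (fun e => BEx a (Elem e))) w.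
Proof. exact: (sem_axiom (a ;; id) w (@ax_union 1 v0)). Qed.

Arguments union_ex : clear implicits.

(** * Totality of the fundamental operations *)

(** [is_pair] and [is_opair] contain unbounded quantifiers and so are not [Sigma0]. These
    equivalents bound every quantifier by the pair or one of its elements, which admits ordered
    pairs in separation and collection. *)
Definition Pair0 p x y :=
  And (BAll p (fun z => Or (Equal z x) (Equal z y))) (And (Elem x p) (Elem y p)).

Definition Opair0 p x y :=
  BEx p (fun a => BEx p (fun b => And (Pair0 a x x) (And (Pair0 b x y) (Pair0 p a b)))).

Definition pair0 {n} (p x y : 'I_n) : form n :=
  (∀∈ p, (v0 ≐ ↑x ∨ v0 ≐ ↑y)) ∧ x ∈ p ∧ y ∈ p.

Definition opair0 {n} (p x y : 'I_n) : form n :=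
  ∃∈ p, ∃∈ ↑p, (pair0 v1 ↑↑x ↑↑x ∧ pair0 v0 ↑↑x ↑↑y ∧ pair0 ↑↑p v1 v0).

Lemma pair0P p x y w : Pair p x y w <-> Pair0 p x y w.
Proof.
split=> [h|[h [hx hy]] z].
  split; last by split; [exact: pair_l h|exact: pair_r h].
  by move=> z; iintro H; apply/(extP z h).
split; iintro H; first exact: ballE h H.
by ior H as H|H; [apply: mem_l hx|apply: mem_l hy]; apply: equal_sym.
Qed.

Lemma Opair0E : Opair = Opair0.
Proof.
apply: functional_extensionality => p; apply: functional_extensionality => x.
apply: functional_extensionality => y; apply: Om_ext => w; split=> h.
  iex h as a h; iex h as b [ha [hb hp]].
  apply: (bexI (pair_l hp)); apply: (bexI (pair_r hp)).
  by split; [|split]; apply/pair0P.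
iex h as a [_ h]; iex h as b [_ [ha [hb hp]]].
by apply: (exI (x := a)); apply: (exI (x := b)); split; [|split]; apply/pair0P.
Qed.

Lemma sem_opair0 n (p x y : 'I_n) r : sem (opair0 p x y) r = Opair (r p) (r x) (r y).
Proof. by rewrite Opair0E. Qed.

Lemma cons_env_shift x r n (i : 'I_n) : (x ;; r) (↑i) = r i.
Proof. by []. Qed.

Lemma cons_env_v0 x r n : (x ;; r) (v0 : 'I_n.+1) = x.
Proof. by []. Qed.

Lemma sem_and n (A B : form n) r P Q : sem A r = P -> sem B r = Q -> sem (A ∧ B) r = And P Q.
Proof. by move=> <- <-. Qed.

Lemma sem_or n (A B : form n) r P Q : sem A r = P -> sem B r = Q -> sem (A ∨ B) r = Or P Q.
Proof. by move=> <- <-. Qed.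

Lemma sem_imp n (A B : form n) r P Q : sem A r = P -> sem B r = Q -> sem (A ⇒ B) r = Imp P Q.
Proof. by move=> <- <-. Qed.

Lemma sem_all n (A : form n.+1) r P : (forall x, sem A (x ;; r) = P x) -> sem (∀' A) r = All P.
Proof. by move=> E; congr All; apply: functional_extensionality. Qed.

Lemma sem_ex n (A : form n.+1) r P : (forall x, sem A (x ;; r) = P x) -> sem (∃' A) r = Ex P.
Proof. by move=> E; congr Ex; apply: functional_extensionality. Qed.

(* Computing the value of nested shifts by conversion alone takes time
   exponential in their depth. *)
Ltac sem_env := unfold v2, v1; rewrite ?cons_env_shift ?cons_env_v0; reflexivity.

Ltac sem_eq :=
  lazymatch goal with
  | |- sem (opair0 _ _ _) _ = _ => rewrite sem_opair0; sem_env
  | |- sem (fand _ _) _ = _ => apply: sem_and; sem_eq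
  | |- sem (for_ _ _) _ = _ => apply: sem_or; sem_eq
  | |- sem (fimp _ _) _ = _ => apply: sem_imp; sem_eq
  | |- sem (fall _) _ = _ => apply: sem_all => ?; sem_eq
  | |- sem (fex _) _ = _ => apply: sem_ex => ?; sem_eq
  | |- sem (fmem ?x ?y) ?r = _ => change (sem (fmem x y) r) with (Elem (r x) (r y)); sem_env
  | |- sem (feq ?x ?y) ?r = _ => change (sem (feq x y) r) with (Equal (r x) (r y)); sem_env
  | |- _ => idtac
  end.

(** * Separation, collection and replacement for truth values *)

Ltac sigma0 := repeat first [assumption | constructor].

(** The predicate [P] is given semantically, with a formula [A] that defines it from the parameters
    [r]. The renaming by [up f] makes room for [b] as one more parameter of the axiom. *)
Lemma separation (P : nat -> Om) n (A : form n.+1) r b w :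
  Sigma0 A -> (forall x, sem A (x ;; r) = P x) ->
  Ex (Ext (fun x => And (Elem x b) (P x))) w.
Proof.
move=> SA semA.
pose f (i : 'I_n) : 'I_n.+1 := ↑i.
have h : Ex (fun z => Ext (fun x => And (Elem x b)
    (sem (ren (up shift) (ren (up f) A)) (x ;; z ;; b ;; r))) z) w.
  exact: (sem_axiom (b ;; r) w (ax_Sigma0_separation ord0 (Sigma0_ren (up f) SA))).
iex h as z h; apply: (exI (x := z)) => x; move: (h x).
rewrite ren_comp (@sem_ren _ _ _ _ _ (x ;; r)) ?semA //.
by apply: ord_shiftP => [|i] /=; rewrite ?up_v0 // !up_shift.
Qed.

Lemma comprehension (P : nat -> Om) n (A : form n.+1) r b w :
  Sigma0 A -> (forall x, sem A (x ;; r) = P x) ->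
  All (fun x => Imp (P x) (Elem x b)) w -> Ex (Ext P) w.
Proof.
move=> SA semA Pb; iex (separation (b := b) (w := w) SA semA) as z h.
apply: (exI (x := z)) => x; split; iintro H; first by have [] := (extP x h).1 H.
by apply/(extP x h); split=> //; apply: mp H.
Qed.

Lemma collection (R : nat -> nat -> Om) n (A : form n.+2) r a w :
  Sigma0 A -> (forall y x, sem A (y ;; x ;; r) = R y x) ->
  BAll a (fun x => Ex (fun y => R y x)) w ->
  Ex (fun b => BAll a (fun x => BEx b (fun y => R y x))) w.
Proof.
move=> SA semA tot.
pose f (i : 'I_n) : 'I_n.+1 := ↑i.
have E y x (s : nat -> nat) : (forall i : 'I_n, s (↑i) = r i) ->
    sem (ren (up (up f)) A) (y ;; x ;; s) = R y x.
  move=> Es; rewrite -semA; apply: sem_ren.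
  apply: ord_shiftP => [|i]; rewrite ?up_v0 // up_shift.
  by move: i; apply: ord_shiftP => [|i]; rewrite ?up_v0 // !up_shift; rewrite /= -Es.
have h : Ex (fun b => BAll a (fun x => BEx b (fun y =>
    sem (ren (up (up shift)) (ren (up (up f)) A)) (y ;; x ;; b ;; a ;; r)))) w.
  apply: (mp (sem_axiom (a ;; r) w (ax_Sigma0_collection ord0 (Sigma0_ren (up (up f)) SA)))).
  move=> x; iintro H; have := ballE tot H => {}H; iex H as y H; apply: (exI (x := y)).
  by suff: sem (ren (up (up f)) A) (y ;; x ;; a ;; r) w by []; rewrite E.
iex h as b h; apply: (exI (x := b)) => x.
iintro H; have := ballE h H; move=> {}h; iex h as y [yb h].
apply: (bexI yb); move: h; rewrite ren_comp (@sem_ren _ _ _ _ _ (y ;; x ;; r)) ?semA //.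
apply: ord_shiftP => [|i]; rewrite /= ?up_v0 // !up_shift.
by move: i; apply: ord_shiftP => [|i]; rewrite ?up_v0 // !up_shift.
Qed.

(** Replacement: collection gives a set [b] with some value for each argument, functionality
    identifies every value with a collected one, and separation from [b] leaves exactly the
    values. *)
Lemma image_ex (R : nat -> nat -> Om) n (A : form n.+2) r a w :
  Sigma0 A -> (forall y x, sem A (y ;; x ;; r) = R y x) ->
  BAll a (fun x => Ex (fun y => R y x)) w ->
  BAll a (fun x => All (fun y => All (fun y' => Imp (R y x) (Imp (R y' x) (Equal y y'))))) w ->
  Ex (Ext (fun y => BEx a (R y))) w.
Proof.
move=> SA semA tot fct; iex (collection SA semA tot) as b h.
(* Swaps value and argument, since the argument is now the innermost bound variable, and skips the
   new parameter [a]. *)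
pose s : 'I_n.+2 -> 'I_n.+3 := insert ord0 v1 (insert ord0 v0 (fun j => ↑↑↑j)).
have SB : Sigma0 (∃∈ v1, ren s A) by constructor; apply: Sigma0_ren.
apply: (comprehension (b := b) SB (r := a ;; r)) => [y|y].
  congr Ex; apply: functional_extensionality => x; congr And; rewrite -semA.
  apply: sem_ren; apply: ord_shiftP => [|i]; rewrite /s ?insert_ord0 // insert_shift.
  by move: i; apply: ord_shiftP => [|i]; rewrite /s ?insert_ord0 // insert_shift.
iintro H; iex H as x [xa Rx]; have h' := ballE h xa; iex h' as y' [yb Ry].
apply: mem_l yb; exact: mp (mp (ballE fct xa y' y) Ry) Rx.
Qed.

(** Replacement is used twice: for fixed x it gives {x} × b, then it gives the set of all these for
    x in [a], whose union is the product. The relation [R z x] is a bounded way of saying z = {x} ×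
    b. *)
Lemma prod_ex a b w : Ex (Ext (fun e => BEx a (fun x => BEx b (fun y => Opair e x y)))) w.
Proof.
pose R z x := And (BAll z (fun p => BEx b (fun y => Opair p x y)))
                  (BAll b (fun y => BEx z (fun p => Opair p x y))).
pose A : form 3 := (∀∈ v0, ∃∈ ↑v2, opair0 v1 ↑↑v1 v0) ∧ (∀∈ v2, ∃∈ ↑v0, opair0 v0 ↑↑v1 v1).
have SA : Sigma0 A by rewrite /A; sigma0.
have RA z x : sem A (z ;; x ;; b ;; id) = R z x by rewrite /A /R; sem_eq.
have RP z x v : R z x v <-> Ext (fun p => BEx b (fun y => Opair p x y)) z v.
  split=> [[h1 h2] p|h].
    split; iintro H; first exact: ballE h1 H.
    iex H as y [yb py]; have h := ballE h2 yb; iex h as q [qz qy].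
    exact: mem_l (opair_unique qy py) qz.
  split; first by move=> p; iintro H; apply/(extP p h).
  move=> y; iintro H; iex (opair_ex x y _) as p hp; apply: (bexI (x := p)) => //.
  by apply/(extP p h)/bexI/hp.
have tot : BAll a (fun x => Ex (fun z => R z x)) w.
  move=> x; iintro _.
  have h : Ex (Ext (fun p => BEx b (fun y => Opair p x y))) w.
    apply: (image_ex (R := fun p y => Opair p x y) (A := (opair0 v0 v2 v1 : form 3)) (r := x ;; id)) => [|p y||].
    - by rewrite /opair0; sigma0.
    - by sem_eq.
    - by move=> y; iintro _; apply: opair_ex.
    - by move=> y; iintro _; move=> p p'; iintro h; iintro h'; apply: opair_unique h h'.
  by iex h as z h; apply: (exI (x := z)); apply/RP.
have fct : BAll a (fun x => All (fun z => All (fun z' => Imp (R z x) (Imp (R z' x) (Equal z z'))))) w.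
  move=> x; iintro _; move=> z z'; iintro h; iintro h'.
  by apply: ext_unique ((RP _ _ _).1 h) ((RP _ _ _).1 h').
iex (image_ex (r := b ;; id) SA RA tot fct) as c hc.
iex (union_ex c _) as d hd; apply: (exI (x := d)) => e; split; iintro H.
  have {}H := (extP e hd).1 H; iex H as z [zc ez].
  have {}zc := (extP z hc).1 zc; iex zc as x [xa zx].
  by apply: (bexI xa); apply/(extP e ((RP _ _ _).1 zx)).
iex H as x [xa H]; have h := ballE tot xa; iex h as z zx.
apply/(extP e hd); apply: (bexI (x := z)); first by apply/(extP z hc)/(bexI xa).
by apply/(extP e ((RP _ _ _).1 zx)).
Qed.

Arguments prod_ex : clear implicits.

(** If <u,v> is in [r], then u and v are elements of {u,v}, which is an element of <u,v>; so the
    double union of [r] works. It bounds the quantifiers over components in the operations below. *)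
Lemma opair_fields_ex r w :
  Ex (fun d => All (fun p => All (fun u => All (fun v =>
    Imp (Elem p r) (Imp (Opair p u v) (And (Elem u d) (Elem v d))))))) w.
Proof.
iex (union_ex r _) as c hc; iex (union_ex c _) as d hd; apply: (exI (x := d)).
move=> p u v; iintro pr; iintro H; iex H as a H; iex H as b [ha [hb hp]].
have bd x : Elem x b w -> Elem x d w.
  move=> xb; apply/(extP x hd)/bexI/xb/(extP b hc)/bexI/(pair_r hp)/pr.
by split; apply: bd; [apply: pair_l hb|apply: pair_r hb].
Qed.

Arguments opair_fields_ex : clear implicits.

Lemma ext_iff (P Q : nat -> Om) w :
  All (fun e => Iff (P e) (Q e)) w -> Ex (Ext P) w -> Ex (Ext Q) w.
Proof.
move=> PQ h; iex h as z h; apply: (exI (x := z)) => e.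
split; iintro H; first by apply/(IffP (PQ e))/(extP e h).
by apply/(extP e h)/(IffP (PQ e)).
Qed.

(** * Existence of the value of each operation *)

Definition InOp F e x y := sem (in_op F v0 v1 v2 : form 3) (e ;; x ;; y ;; id).

Lemma imp_ex x y w : Ex (Ext (fun e => InOp op_imp e x y)) w.
Proof.
(* The components of the pair [y] are elements of elements of [y], which bounds both quantifiers. *)
pose P e := BEx y (fun c => BEx y (fun d => BEx c (fun u => BEx d (fun v =>
  And (Opair y u v) (Imp (Elem e u) (Elem e v)))))).
pose A : form 3 := ∃∈ v2, ∃∈ ↑v2, ∃∈ v1, ∃∈ v1,
  (opair0 ↑↑↑↑v2 v1 v0 ∧ (↑↑↑↑v0 ∈ v1 ⇒ ↑↑↑↑v0 ∈ v0)).
have SA : Sigma0 A by rewrite /A /opair0; sigma0.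
have semA e : sem A (e ;; x ;; y ;; id) = P e by rewrite /A /P; sem_eq.
apply: ext_iff (separation (b := x) SA semA).
move=> e; apply: iff_of => {}w; split=> [[ex h]|[ex h]]; split=> //.
  iex h as c [_ h]; iex h as d [_ h]; iex h as u [_ h]; iex h as v [_ h].
  by apply: (exI (x := u)); apply: (exI (x := v)).
iex h as u h; iex h as v [yuv h]; have H := yuv.
iex H as a H; iex H as b [ha [hb hy]].
apply: (bexI (pair_l hy)); apply: (bexI (pair_r hy)).
by apply: (bexI (pair_l ha)); apply: (bexI (pair_r hb)).
Qed.

Lemma dom_ex x y w : Ex (Ext (fun e => InOp op_dom e x y)) w.
Proof.
iex (opair_fields_ex x _) as d hd.
pose P e := BEx x (fun p => BEx d (fun v => Opair p e v)).
pose A : form 3 := ∃∈ v1, ∃∈ ↑v2, opair0 v1 ↑↑v0 v0.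
have SA : Sigma0 A by rewrite /A /opair0; sigma0.
have semA e : sem A (e ;; x ;; d ;; id) = P e by rewrite /A /P; sem_eq.
apply: ext_iff (separation (b := d) SA semA) => e; split; iintro H.
  have [_ {}H] := H; iex H as p [px H]; iex H as v [_ H].
  by apply: (bexI px); apply: (exI (x := v)).
iex H as p [px H]; iex H as v H; have [ed vd] := mp (mp (hd p e v) px) H.
by split=> //; apply: (bexI px); apply: (bexI vd).
Qed.

Lemma ran_ex x y w : Ex (Ext (fun e => InOp op_ran e x y)) w.
Proof.
iex (opair_fields_ex x _) as d hd.
pose P e := BEx x (fun p => BEx d (fun v => Opair p v e)).
pose A : form 3 := ∃∈ v1, ∃∈ ↑v2, opair0 v1 v0 ↑↑v0.
have SA : Sigma0 A by rewrite /A /opair0; sigma0.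
have semA e : sem A (e ;; x ;; d ;; id) = P e by rewrite /A /P; sem_eq.
apply: ext_iff (separation (b := d) SA semA) => e; split; iintro H.
  have [_ {}H] := H; iex H as p [px H]; iex H as v [_ H].
  by apply: (bexI px); apply: (exI (x := v)).
iex H as p [px H]; iex H as v H; have [vd ed] := mp (mp (hd p v e) px) H.
by split=> //; apply: (bexI px); apply: (bexI vd).
Qed.

(* [T t v z] is [t = <v, z>] for [op_uvw] and [t = <z, v>] for [op_uwv]. *)
Lemma triples_ex (T : nat -> nat -> nat -> Om) (TA : forall n, 'I_n -> 'I_n -> 'I_n -> form n) x y w :
  (forall n (t v z : 'I_n), Sigma0 (TA n t v z)) ->
  (forall n (t v z : 'I_n) r, sem (TA n t v z) r = T (r t) (r v) (r z)) ->
  (forall d w, Ex (fun q => All (fun t => All (fun v => All (fun z =>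
    Imp (Elem v d) (Imp (Elem z y) (Imp (T t v z) (Elem t q))))))) w) ->
  Ex (Ext (fun e => Ex (fun u => Ex (fun v => BEx y (fun z =>
    And (BEx x (fun p => Opair p u v)) (Ex (fun t => And (T t v z) (Opair e u t)))))))) w.
Proof.
move=> STA semT bT.
(* Every element sought is <u,t> with u in [d] and t in [q], hence lies in [d × q], and all its
   witnesses are bounded by [d], [y], [x] and [q]. *)
iex (opair_fields_ex x _) as d hd; iex (bT d _) as q hq; iex (prod_ex d q _) as b hb.
pose P e := BEx d (fun u => BEx d (fun v => BEx y (fun z => And (BEx x (fun p => Opair p u v))
  (BEx q (fun t => And (T t v z) (Opair e u t)))))).
pose A : form 5 := ∃∈ v2, ∃∈ ↑v2, ∃∈ ↑↑↑↑v2,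
  ((∃∈ ↑↑↑v1, opair0 v0 ↑↑↑v0 ↑↑v0) ∧
   (∃∈ ↑↑↑↑v2, (TA _ v0 ↑↑v0 ↑v0 ∧ opair0 ↑↑↑↑v0 ↑↑↑v0 v0))).
have SA : Sigma0 A by rewrite /A /opair0; sigma0.
have semA e : sem A (e ;; x ;; d ;; q ;; y ;; id) = P e.
  by rewrite /A /P; sem_eq; rewrite semT; sem_env.
apply: ext_iff (separation (b := b) SA semA) => e; split; iintro H.
  have [_ {}H] := H; iex H as u [ud H]; iex H as v [vd H]; iex H as z [zy [H H']].
  apply: (exI (x := u)); apply: (exI (x := v)); apply: (bexI zy); split=> //.
  by iex H' as t [_ H']; apply: (exI (x := t)).
iex H as u H; iex H as v H; iex H as z [zy [H H']].
have pxuv := H; iex pxuv as p [px uv]; have [ud vd] := mp (mp (hd p u v) px) uv.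
iex H' as t [tvz et]; have tq := mp (mp (mp (hq t v z) vd) zy) tvz.
split.
  by apply/(extP e hb); apply: (bexI ud); apply: (bexI tq).
apply: (bexI ud); apply: (bexI vd); apply: (bexI zy); split=> //.
by apply: (bexI tq).
Qed.

Lemma uvw_ex x y w : Ex (Ext (fun e => InOp op_uvw e x y)) w.
Proof.
apply: (triples_ex (T := Opair) (TA := @opair0)) => [n t v z|n t v z r|d {}w].
- by rewrite /opair0; sigma0.
- exact: sem_opair0.
iex (prod_ex d y _) as q hq; apply: (exI (x := q)) => t v z.
iintro vd; iintro zy; iintro tvz.
by apply/(extP t hq); apply: (bexI vd); apply: (bexI zy).
Qed.

Lemma uwv_ex x y w : Ex (Ext (fun e => InOp op_uwv e x y)) w.
Proof.
apply: (triples_ex (T := fun t v z => Opair t z v) (TA := fun n t v z => opair0 t z v))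
  => [n t v z|n t v z r|d {}w].
- by rewrite /opair0; sigma0.
- exact: sem_opair0.
iex (prod_ex y d _) as q hq; apply: (exI (x := q)) => t v z.
iintro vd; iintro zy; iintro tvz.
by apply/(extP t hq); apply: (bexI zy); apply: (bexI vd).
Qed.

Lemma section_ex x z w : Ex (Ext (fun u => BEx x (fun p => Opair p z u))) w.
Proof.
iex (opair_fields_ex x _) as d hd.
pose A : form 3 := ∃∈ v1, opair0 v0 ↑v2 ↑v0.
have SA : Sigma0 A by rewrite /A /opair0; sigma0.
have semA u : sem A (u ;; x ;; z ;; id) = BEx x (fun p => Opair p z u) by rewrite /A; sem_eq.
apply: (comprehension (b := d) SA semA) => u.
by iintro h; iex h as p [px h]; have [] := mp (mp (hd p z u) px) h.
Qed.

Arguments section_ex : clear implicits.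

Lemma sections_ex x y w : Ex (Ext (fun e => InOp op_sections e x y)) w.
Proof.
iex (opair_fields_ex x _) as d hd.
pose S z u := BEx x (fun p => Opair p z u).
(* A bounded form of the statement that [e] is the section of [x] at [z]; [d] contains every second
   component of a pair in [x]. *)
pose R e z := And (BAll e (S z)) (BAll x (fun p => BAll d (fun u => Imp (Opair p z u) (Elem u e)))).
have RP : All (fun z => All (fun e => Iff (R e z) (Ext (S z) e))) w.
  move=> z e; split; iintro H.
    have [H1 H2] := H; move=> u; split; iintro h; first exact: ballE H1 h.
    iex h as p [px h]; have [_ ud] := mp (mp (hd p z u) px) h.
    exact: mp (ballE (ballE H2 px) ud) h.
  split; first by move=> u; iintro h; apply/(extP u H).
  move=> p; iintro px; move=> u; iintro ud; iintro h.
  by apply/(extP u H)/(bexI px).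
pose A : form 4 := (∀∈ v0, ∃∈ ↑v2, opair0 v0 ↑↑v1 v1) ∧
  (∀∈ v2, ∀∈ ↑↑v2, (opair0 v1 ↑↑v1 v0 ⇒ v0 ∈ ↑↑v0)).
have SA : Sigma0 A by rewrite /A /opair0; sigma0.
have semA e z : sem A (e ;; z ;; x ;; d ;; id) = R e z by rewrite /A /R /S; sem_eq.
have tot : BAll y (fun z => Ex (fun e => R e z)) w.
  move=> z; iintro _; iex (section_ex x z _) as e h.
  by apply: (exI (x := e)); apply/(IffP (RP z e)).
have fct : BAll y (fun z => All (fun e => All (fun e' => Imp (R e z) (Imp (R e' z) (Equal e e'))))) w.
  move=> z; iintro _; move=> e e'; iintro h; iintro h'.
  by apply: ext_unique ((IffP (RP z e)).1 h) ((IffP (RP z e')).1 h').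
apply: ext_iff (image_ex SA semA tot fct) => e; split; iintro H; iex H as z [zy H];
  apply: (bexI zy); exact/(IffP (RP z e)).
Qed.

Lemma op_ex F x y w : Ex (Ext (fun e => InOp F e x y)) w.
Proof.
(* [same] covers the operations that cut out a subset of [x], and [prod] those that cut out a subset
   of y × x. *)
have same (A : form 3) (P : nat -> Om) : Sigma0 A -> (forall e, sem A (e ;; x ;; y ;; id) = P e) ->
    Ex (Ext (fun e => And (Elem e x) (P e))) w by apply: separation.
have prod (A : form 3) P : Sigma0 A ->
    (forall e, sem A (e ;; x ;; y ;; id) = BEx y (fun v => BEx x (fun u => And (Opair e v u) (P u v)))) ->
    Ex (Ext (fun e => BEx y (fun v => BEx x (fun u => And (Opair e v u) (P u v))))) w.
  move=> SA semA; iex (prod_ex y x _) as b hb.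
  apply: (comprehension (b := b) SA semA) => e; iintro H.
  iex H as v [vy H]; iex H as u [ux [H _]].
  by apply/(extP e hb)/(bexI vy)/(bexI ux).
case: F.
- exact: pair_ex.
- by apply: (same (∀∈ v2, ↑v0 ∈ v0)) => [|e]; [sigma0|sem_eq].
- exact: union_ex.
- by apply: (same (¬ v0 ∈ v2)) => [|e]; [sigma0|sem_eq].
- exact: prod_ex.
- exact: imp_ex.
- exact: sections_ex.
- exact: dom_ex.
- exact: ran_ex.
- exact: uvw_ex.
- exact: uwv_ex.
- by apply: (prod (∃∈ v2, ∃∈ ↑v1, (opair0 ↑↑v0 v1 v0 ∧ v0 ≐ v1)) (fun u v => Equal u v)) => [|e];
    [rewrite /opair0; sigma0|sem_eq].
- by apply: (prod (∃∈ v2, ∃∈ ↑v1, (opair0 ↑↑v0 v1 v0 ∧ v0 ∈ v1)) (fun u v => Elem u v)) => [|e];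
    [rewrite /opair0; sigma0|sem_eq].
Qed.

Arguments op_ex : clear implicits.

(** * Values of terms *)

Lemma sem_in_op n F (e x y : 'I_n) r : sem (in_op F e x y) r = InOp F (r e) (r x) (r y).
Proof. by case: F. Qed.

Lemma in_op_congr F e x x' y y' w :
  Equal x x' w -> Equal y y' w -> InOp F e x y w -> InOp F e x' y' w.
Proof.
move=> ex ey h.
have := @eq_subst 2 (in_op F v1 v0 v2) (e ;; y ;; id) x x' w ex.
rewrite !sem_in_op => /(_ h) {}h.
have := @eq_subst 2 (in_op F v1 v2 v0) (e ;; x' ;; id) y y' w ey.
by rewrite !sem_in_op => /(_ h).
Qed.

Fixpoint tvalue n (t : op_term n) (e : 'I_n -> nat) (z : nat) : Om :=
  match t with
  | tvar j => Equal z (e j)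
  | tapp F s t => Ex (fun p => Ex (fun q =>
      And (tvalue s e p) (And (tvalue t e q) (Ext (fun x => InOp F x p q) z))))
  end.

(** Without function symbols, membership in a term has to refer to some value of it; [tvalue_ex] and
    [tvalue_unique] make the choice of the value immaterial. *)
Definition tmem n (t : op_term n) e x := Ex (fun z => And (tvalue t e z) (Elem x z)).
Definition tpair n (t : op_term n) e u v := Ex (fun p => And (Opair p u v) (tmem t e p)).

Lemma sem_term_graph n (t : op_term n) m (args : 'I_n -> 'I_m) z (r : nat -> nat) :
  sem (term_graph t args z) r = tvalue t (fun j => r (args j)) (r z).
Proof.
elim: t m args z r => //= F s IHs t IHt m args z r.
congr Ex; apply: functional_extensionality => p.
congr Ex; apply: functional_extensionality => q.
rewrite IHs IHt; congr (And _ (And _ _)).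
congr All; apply: functional_extensionality => x.
by rewrite sem_in_op.
Qed.

Lemma tvalue_ex n (t : op_term n) e w : Ex (tvalue t e) w.
Proof.
elim: t w => [j|F s IHs t IHt] w; first exact/exI/equal_refl.
iex (IHs _) as p hp; iex (IHt _) as q hq; iex (op_ex F p q _) as z hz.
by apply: (exI (x := z)); apply: (exI (x := p)); apply: (exI (x := q)).
Qed.

Arguments tvalue_ex {n} t e w.

Lemma tvalue_unique n (t : op_term n) e z z' w : tvalue t e z w -> tvalue t e z' w -> Equal z z' w.
Proof.
elim: t z z' w => [j|F s IHs t IHt] z z' w h h'; first exact: equal_trans h (equal_sym h').
iex h as p h; iex h as q [hp [hq h]]; iex h' as p' h'; iex h' as q' [hp' [hq' h']].
have ep := IHs _ _ _ hp' hp; have eq := IHt _ _ _ hq' hq.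
apply: (ext_unique h) => x; split; iintro H.
  by apply: (in_op_congr ep eq); apply/(extP x h').
by apply/(extP x h'); apply: in_op_congr H; apply: equal_sym.
Qed.

Lemma tvalue_congr n (t : op_term n) e z z' w : Equal z z' w -> tvalue t e z w -> tvalue t e z' w.
Proof.
case: t => [j|F s t] ez h; first exact: equal_trans (equal_sym ez) h.
iex h as p h; iex h as q [hp [hq h]].
apply: (exI (x := p)); apply: (exI (x := q)); split=> //; split=> // x.
split; iintro H; first exact/(extP x h)/(mem_r (equal_sym ez)).
by apply: (mem_r ez); apply/(extP x h).
Qed.

Lemma tvalue_app n F (s t : op_term n) e p q z w :
  tvalue s e p w -> tvalue t e q w -> tvalue (tapp F s t) e z w -> Ext (fun x => InOp F x p q) z w.
Proof.
move=> hp hq h; iex h as p' h; iex h as q' [hp' [hq' h]].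
have ep := tvalue_unique hp' hp; have eq := tvalue_unique hq' hq => x.
split; iintro H; first exact/(in_op_congr ep eq)/(extP x h).
by apply/(extP x h); apply: in_op_congr H; apply: equal_sym.
Qed.

Lemma tvalue_mem n (t : op_term n) e z x w : tvalue t e z w -> (Elem x z w <-> tmem t e x w).
Proof.
move=> hz; split=> h; first by apply: (exI (x := z)).
by iex h as z' [hz' h]; apply: mem_r h; apply: tvalue_unique hz' hz.
Qed.

Lemma tapp_mem n F (s t : op_term n) e p q x w :
  tvalue s e p w -> tvalue t e q w -> (tmem (tapp F s t) e x w <-> InOp F x p q w).
Proof.
move=> hp hq; split=> h.
  by iex h as z [hz h]; apply/(extP x (tvalue_app hp hq hz)).
iex (tvalue_ex (tapp F s t) e _) as z hz.
by apply/(tvalue_mem x hz)/(extP x (tvalue_app hp hq hz)).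
Qed.

Lemma tmem_congr n (t : op_term n) e x x' w : Equal x x' w -> tmem t e x w -> tmem t e x' w.
Proof. by move=> ex h; iex h as z [hz h]; apply/(tvalue_mem x' hz)/(mem_l ex). Qed.

Lemma tpairP n (t : op_term n) e p u v w : Opair p u v w -> (tmem t e p w <-> tpair t e u v w).
Proof.
move=> hp; split=> h; first by apply: (exI (x := p)).
by iex h as q [hq h]; apply: tmem_congr h; apply: opair_unique hq hp.
Qed.

Lemma tpair_congr n (t : op_term n) e u u' v v' w :
  Equal u u' w -> Equal v v' w -> tpair t e u v w -> tpair t e u' v' w.
Proof.
move=> eu ev h; iex h as p [hp h]; apply: (exI (x := p)); split=> //.
exact: opair_congr (equal_refl p w) eu ev hp.
Qed.

Lemma tpair_of n (t : op_term n) e r u v w :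
  tvalue t e r w -> (BEx r (fun p => Opair p u v) w <-> tpair t e u v w).
Proof.
move=> hr; split=> h; iex h as p [h1 h2].
  by apply: (exI (x := p)); split=> //; apply/(tvalue_mem p hr).
by apply: (bexI (x := p)) => //; apply/(tvalue_mem p hr).
Qed.

(** * Elements and pairs in the values of composite terms *)

Lemma Om_eq (P Q : Om) : (forall w, Iff P Q w) -> P = Q.
Proof. by move=> PQ; apply: Om_ext => w; apply/IffP. Qed.

(** Binary intersection is s ∩ ⋂{t}, with {t} obtained by pairing [t] with itself. *)
Lemma tmem_inter n (s t : op_term n) e x :
  tmem (tapp op_inter s (tapp op_pair t t)) e x = And (tmem s e x) (tmem t e x).
Proof.
apply: Om_eq => w; iex (tvalue_ex s e w) as p hp; iex (tvalue_ex t e _) as q hq.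
iex (tvalue_ex (tapp op_pair t t) e _) as c hc; have cP := tvalue_app hq hq hc.
split; iintro H.
  have [xp xc] := (tapp_mem _ _ hp hc).1 H.
  by split; [apply/(tvalue_mem x hp)|apply/(tvalue_mem x hq)/(ballE xc)/(extP q cP)/orI1/equal_refl].
have [xs xt] := H; apply/(tapp_mem op_inter x hp hc); split; first exact/(tvalue_mem x hp).
move=> y; iintro yc; have {}yc : Or (Equal y q) (Equal y q) w by apply/(extP y cP).
by ior yc as E|E; apply: (mem_r (equal_sym E)); apply/(tvalue_mem x hq).
Qed.

Lemma tmem_union n (s t : op_term n) e x :
  tmem (tapp op_union (tapp op_pair s t) s) e x = Or (tmem s e x) (tmem t e x).
Proof.
apply: Om_eq => w; iex (tvalue_ex s e w) as p hp; iex (tvalue_ex t e _) as q hq.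
iex (tvalue_ex (tapp op_pair s t) e _) as c hc; have cP := tvalue_app hp hq hc.
split; iintro H.
  have {}H := (tapp_mem _ _ hc hp).1 H; iex H as y [yc xy].
  have {}yc : Or (Equal y p) (Equal y q) w by apply/(extP y cP).
  ior yc as E|E; [apply: orI1; apply/(tvalue_mem x hp)|apply: orI2; apply/(tvalue_mem x hq)];
  exact: mem_r xy.
apply/(tapp_mem op_union x hc hp); ior H as H|H.
  by apply: (bexI (x := p)); [apply/(extP p cP)/orI1/equal_refl|apply/(tvalue_mem x hp)].
by apply: (bexI (x := q)); [apply/(extP q cP)/orI2/equal_refl|apply/(tvalue_mem x hq)].
Qed.

Lemma tmem_bigunion n (s t : op_term n) e x :
  tmem (tapp op_union s t) e x = Ex (fun y => And (tmem s e y) (Elem x y)).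
Proof.
apply: Om_eq => w; iex (tvalue_ex s e w) as p hp; iex (tvalue_ex t e _) as q hq.
split; iintro H.
  have {}H := (tapp_mem _ _ hp hq).1 H; iex H as y [yp xy].
  by apply: (exI (x := y)); split=> //; apply/(tvalue_mem y hp).
apply/(tapp_mem op_union x hp hq); iex H as y [H xy].
by apply: bexI xy; apply/(tvalue_mem y hp).
Qed.

Lemma tmem_diff n (s : op_term n) e x : tmem (tapp op_diff s s) e x = Bot.
Proof.
apply: Om_eq => w; iex (tvalue_ex s e w) as p hp; split; iintro H; last exact: botE.
by have [xp nxp] := (tapp_mem _ _ hp hp).1 H; apply: mp nxp xp.
Qed.

(** The nested pairings spell out <a,b>; injectivity of ordered pairs then identifies the components
    that [op_imp] speaks of with the values of [a] and [b]. *)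
Lemma tmem_imp n (s a b : op_term n) e x :
  tmem (tapp op_imp s (tapp op_pair (tapp op_pair a a) (tapp op_pair a b))) e x =
  And (tmem s e x) (Imp (tmem a e x) (tmem b e x)).
Proof.
apply: Om_eq => w; iex (tvalue_ex s e w) as p hp.
iex (tvalue_ex a e _) as u hu; iex (tvalue_ex b e _) as v hv.
iex (tvalue_ex (tapp op_pair a a) e _) as c hc; iex (tvalue_ex (tapp op_pair a b) e _) as d hd.
iex (tvalue_ex (tapp op_pair (tapp op_pair a a) (tapp op_pair a b)) e _) as y hy.
have yuv : Opair y u v w.
  apply: (exI (x := c)); apply: (exI (x := d)); split; first exact: tvalue_app hc.
  by split; [apply: tvalue_app hd|apply: tvalue_app hy].
split; iintro H.
  have [xp {}H] := (tapp_mem _ _ hp hy).1 H; iex H as u' H; iex H as v' [yuv' H].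
  have eu := opair_inj1 yuv yuv'; have ev := opair_inj2 yuv yuv'.
  split; first exact/(tvalue_mem x hp).
  iintro xa; apply/(tvalue_mem x hv)/(mem_r (equal_sym ev))/(mp H)/(mem_r eu).
  exact/(tvalue_mem x hu).
have [xs {}H] := H; apply/(tapp_mem op_imp x hp hy); split; first exact/(tvalue_mem x hp).
apply: (exI (x := u)); apply: (exI (x := v)); split=> //.
by iintro xu; apply/(tvalue_mem x hv)/(mp H)/(tvalue_mem x hu).
Qed.

(** This yields the bounded universal quantifier. For z in [a] the section of [t] at z exists and is
    one of the sets intersected, so lying in all of them means being related to every such z. For
    empty [a] all of [s] remains. *)
Lemma tmem_sections n (s t a : op_term n) e x :
  tmem (tapp op_inter s (tapp op_sections t a)) e x =
  And (tmem s e x) (All (fun z => Imp (tmem a e z) (tpair t e z x))).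
Proof.
apply: Om_eq => w; iex (tvalue_ex s e w) as p hp; iex (tvalue_ex t e _) as r hr.
iex (tvalue_ex a e _) as y hy; iex (tvalue_ex (tapp op_sections t a) e _) as c hc.
have cP := tvalue_app hr hy hc.
split; iintro H.
  have [xp xc] := (tapp_mem _ _ hp hc).1 H; split; first exact/(tvalue_mem x hp).
  move=> z; iintro za; iex (section_ex r z _) as d hd.
  apply/(tpair_of z x hr)/(extP x hd)/(ballE xc)/(extP d cP).
  by apply: (bexI (x := z)); [apply/(tvalue_mem z hy)|].
have [xs {}H] := H; apply/(tapp_mem op_inter x hp hc); split; first exact/(tvalue_mem x hp).
move=> d; iintro dc; have {}dc := (extP d cP).1 dc; iex dc as z [zy dz].
apply: (IffP (dz x)).2; apply/(tpair_of z x hr)/(mp (H z)).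
exact/(tvalue_mem z hy).
Qed.

Lemma tmem_dom n (s t : op_term n) e u :
  tmem (tapp op_dom s t) e u = Ex (fun v => tpair s e u v).
Proof.
apply: Om_eq => w; iex (tvalue_ex s e w) as p hp; iex (tvalue_ex t e _) as q hq.
split; iintro H.
  have {}H := (tapp_mem _ _ hp hq).1 H; iex H as z [zp H]; iex H as v H.
  by apply: (exI (x := v)); apply/(tpair_of u v hp)/bexI/H.
apply/(tapp_mem op_dom u hp hq); iex H as v H.
have {}H := (tpair_of u v hp).2 H; iex H as z [zp H].
by apply: (bexI zp); apply: (exI (x := v)).
Qed.

Lemma tmem_ran n (s t : op_term n) e v :
  tmem (tapp op_ran s t) e v = Ex (fun u => tpair s e u v).
Proof.
apply: Om_eq => w; iex (tvalue_ex s e w) as p hp; iex (tvalue_ex t e _) as q hq.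
split; iintro H.
  have {}H := (tapp_mem _ _ hp hq).1 H; iex H as z [zp H]; iex H as u H.
  by apply: (exI (x := u)); apply/(tpair_of u v hp)/bexI/H.
apply/(tapp_mem op_ran v hp hq); iex H as u H.
have {}H := (tpair_of u v hp).2 H; iex H as z [zp H].
by apply: (bexI zp); apply: (exI (x := u)).
Qed.

Lemma tpair_prod n (s t : op_term n) e u v :
  tpair (tapp op_prod s t) e u v = And (tmem s e u) (tmem t e v).
Proof.
apply: Om_eq => w; iex (tvalue_ex s e w) as p hp; iex (tvalue_ex t e _) as q hq.
split; iintro H.
  iex H as z [zuv H]; have {}H := (tapp_mem _ _ hp hq).1 H.
  iex H as u' [u'p H]; iex H as v' [v'q H].
  split; first exact/(tvalue_mem u hp)/(mem_l (opair_inj1 H zuv)).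
  exact/(tvalue_mem v hq)/(mem_l (opair_inj2 H zuv)).
have [us vt] := H; iex (opair_ex u v _) as z zuv; apply/(tpairP _ _ zuv).
apply/(tapp_mem op_prod z hp hq); apply: (bexI (x := u)); first exact/(tvalue_mem u hp).
by apply: (bexI (x := v)); first exact/(tvalue_mem v hq).
Qed.

Lemma tpair_eq n (s t : op_term n) e u v :
  tpair (tapp op_eq s t) e v u = And (tmem t e v) (And (tmem s e u) (Equal u v)).
Proof.
apply: Om_eq => w; iex (tvalue_ex s e w) as p hp; iex (tvalue_ex t e _) as q hq.
split; iintro H.
  iex H as z [zuv H]; have {}H := (tapp_mem _ _ hp hq).1 H.
  iex H as v' [v'q H]; iex H as u' [u'p [H E]].
  have ev := opair_inj1 H zuv; have eu := opair_inj2 H zuv.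
  split; first exact/(tvalue_mem v hq)/(mem_l ev).
  by split; [apply/(tvalue_mem u hp)/(mem_l eu)|ieq].
have [vt [us E]] := H; iex (opair_ex v u _) as z zvu; apply/(tpairP _ _ zvu).
apply/(tapp_mem op_eq z hp hq); apply: (bexI (x := v)); first exact/(tvalue_mem v hq).
by apply: (bexI (x := u)); first exact/(tvalue_mem u hp).
Qed.

Lemma tpair_mem n (s t : op_term n) e u v :
  tpair (tapp op_mem s t) e v u = And (tmem t e v) (And (tmem s e u) (Elem u v)).
Proof.
apply: Om_eq => w; iex (tvalue_ex s e w) as p hp; iex (tvalue_ex t e _) as q hq.
split; iintro H.
  iex H as z [zuv H]; have {}H := (tapp_mem _ _ hp hq).1 H.
  iex H as v' [v'q H]; iex H as u' [u'p [H E]].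
  have ev := opair_inj1 H zuv; have eu := opair_inj2 H zuv.
  split; first exact/(tvalue_mem v hq)/(mem_l ev).
  by split; [apply/(tvalue_mem u hp)/(mem_l eu)|apply/(mem_l eu)/(mem_r ev)].
have [vt [us E]] := H; iex (opair_ex v u _) as z zvu; apply/(tpairP _ _ zvu).
apply/(tapp_mem op_mem z hp hq); apply: (bexI (x := v)); first exact/(tvalue_mem v hq).
by apply: (bexI (x := u)); first exact/(tvalue_mem u hp).
Qed.

(** As <u,v,z> is <u,<v,z>>, the operation leaves the first component alone and extends the point v
    to <v,z>. In [tpair_uwv] the new entry z is put in front of v instead. *)
Lemma tpair_uvw n (s t : op_term n) e u v z r w :
  Opair r v z w -> (tpair (tapp op_uvw s t) e u r w <-> And (tpair s e u v) (tmem t e z) w).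
Proof.
move=> rvz; split=> H; iex (tvalue_ex s e _) as p hp; iex (tvalue_ex t e _) as q hq.
  iex H as c [cur H]; have {}H := (tapp_mem _ _ hp hq).1 H.
  iex H as u' H; iex H as v' H; iex H as z' [z'q [H H']]; iex H' as r' [r'vz cu'].
  have eu := opair_inj1 cu' cur.
  have rvz' := opair_congr (opair_inj2 cu' cur) (equal_refl v' w) (equal_refl z' w) r'vz.
  have ev := opair_inj1 rvz' rvz; have ez := opair_inj2 rvz' rvz.
  split; last exact/(tvalue_mem z hq)/(mem_l ez).
  by apply: (tpair_congr eu ev); apply/(tpair_of u' v' hp).
have [uv zt] := H; iex (opair_ex u r _) as c cur; apply/(tpairP _ _ cur).
apply/(tapp_mem op_uvw c hp hq); apply: (exI (x := u)); apply: (exI (x := v)).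
apply: (bexI (x := z)); first exact/(tvalue_mem z hq).
by split; [apply/(tpair_of u v hp)|apply: (exI (x := r))].
Qed.

Lemma tpair_uwv n (s t : op_term n) e u v z r w :
  Opair r z v w -> (tpair (tapp op_uwv s t) e u r w <-> And (tpair s e u v) (tmem t e z) w).
Proof.
move=> rvz; split=> H; iex (tvalue_ex s e _) as p hp; iex (tvalue_ex t e _) as q hq.
  iex H as c [cur H]; have {}H := (tapp_mem _ _ hp hq).1 H.
  iex H as u' H; iex H as v' H; iex H as z' [z'q [H H']]; iex H' as r' [r'vz cu'].
  have eu := opair_inj1 cu' cur.
  have rvz' := opair_congr (opair_inj2 cu' cur) (equal_refl z' w) (equal_refl v' w) r'vz.
  have ez := opair_inj1 rvz' rvz; have ev := opair_inj2 rvz' rvz.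
  split; last exact/(tvalue_mem z hq)/(mem_l ez).
  by apply: (tpair_congr eu ev); apply/(tpair_of u' v' hp).
have [uv zt] := H; iex (opair_ex u r _) as c cur; apply/(tpairP _ _ cur).
apply/(tapp_mem op_uwv c hp hq); apply: (exI (x := u)); apply: (exI (x := v)).
apply: (bexI (x := z)); first exact/(tvalue_mem z hq).
by split; [apply/(tpair_of u v hp)|apply: (exI (x := r))].
Qed.

(** * Separation by terms *)

Lemma tpair_inter n (s t : op_term n) e u v :
  tpair (tapp op_inter s (tapp op_pair t t)) e u v = And (tpair s e u v) (tpair t e u v).
Proof.
apply: Om_eq => w; iex (opair_ex u v _) as p hp; split; iintro H.
  have {}H := (tpairP _ _ hp).2 H; rewrite tmem_inter in H; have [Hs Ht] := H.
  by split; apply/(tpairP _ _ hp).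
by have [Hs Ht] := H; apply/(tpairP _ _ hp); rewrite tmem_inter; split; apply/(tpairP _ _ hp).
Qed.

(** Functionality of an extended coordinate concerns an arbitrary second component [r], which must
    first be recognised as an ordered pair. *)
Lemma tpair_uvw_opair n (s t : op_term n) e u r w :
  tpair (tapp op_uvw s t) e u r w -> Ex (fun v => Ex (fun z => Opair r v z)) w.
Proof.
move=> H; iex (tvalue_ex s e _) as p hp; iex (tvalue_ex t e _) as q hq.
iex H as c [cur H]; have {}H := (tapp_mem _ _ hp hq).1 H.
iex H as u' H; iex H as v' H; iex H as z' [z'q [H H']]; iex H' as r' [r'vz cu'].
apply: (exI (x := v')); apply: (exI (x := z')).
exact: opair_congr (opair_inj2 cu' cur) (equal_refl v' w) (equal_refl z' w) r'vz.
Qed.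

Lemma tpair_uwv_opair n (s t : op_term n) e u r w :
  tpair (tapp op_uwv s t) e u r w -> Ex (fun z => Ex (fun v => Opair r z v)) w.
Proof.
move=> H; iex (tvalue_ex s e _) as p hp; iex (tvalue_ex t e _) as q hq.
iex H as c [cur H]; have {}H := (tapp_mem _ _ hp hq).1 H.
iex H as u' H; iex H as v' H; iex H as z' [z'q [H H']]; iex H' as r' [r'vz cu'].
apply: (exI (x := z')); apply: (exI (x := v')).
exact: opair_congr (opair_inj2 cu' cur) (equal_refl z' w) (equal_refl v' w) r'vz.
Qed.

(** Coordinate graphs list the value first and the point second, so it is the second component that
    determines the first. *)
Definition functional n (t : op_term n) e :=
  All (fun x => All (fun y => All (fun s => Imp (tpair t e x s) (Imp (tpair t e y s) (Equal x y))))).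

Definition represents k n (P : 'I_k -> op_term n) e (x : nat -> nat) s :=
  All (fun j => And (functional (P j) e) (tpair (P j) e (x j) s)).

Lemma functionalP n (t : op_term n) e x y s w :
  functional t e w -> tpair t e x s w -> tpair t e y s w -> Equal x y w.
Proof. by move=> f hx hy; apply: mp (mp (f x y s) hx) hy. Qed.

Definition separates n (E S : op_term n) k (P : 'I_k -> op_term n) (A : form k) :=
  forall e x s w, tmem S e s w -> represents P e x s w -> (tmem E e s w <-> sem A x w).

Lemma separates_mem n (S : op_term n) k (P : 'I_k -> op_term n) i j :
  exists E, separates E S P (i ∈ j).
Proof.
(* [U] and [V] hold the values of the coordinates i and j. [M1] consists of the <v,u,s> with <v,s>
   in P_j and u in [U], while [M2] requires u ∈ v; so [R] consists of the <u,s> with u an element of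
   coordinate j at s. *)
pose U := tapp op_dom (P i) (P i); pose V := tapp op_dom (P j) (P j).
pose M1 := tapp op_uwv (P j) U; pose M2 := tapp op_uvw (tapp op_mem U V) S.
pose N := tapp op_inter M1 (tapp op_pair M2 M2); pose R := tapp op_ran N N.
pose N' := tapp op_inter (P i) (tapp op_pair R R).
exists (tapp op_ran N' N') => e x s w sS rep; rewrite tmem_ran.
have [fi xi] := rep i; have [fj xj] := rep j.
split=> H.
  iex H as u H; rewrite tpair_inter in H; have [ui uR] := H.
  iex (opair_ex u s _) as p hp; have {}uR := (tpairP _ _ hp).2 uR.
  rewrite tmem_ran in uR; iex uR as v vp; rewrite tpair_inter in vp; have [v1 v2] := vp.
  have [vs _] := (tpair_uwv _ _ _ _ hp).1 v1.
  have [vu _] := (tpair_uvw _ _ _ _ hp).1 v2.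
  rewrite tpair_mem in vu; have [_ [_ uv]] := vu.
  exact: mem_l (functionalP fi ui xi) (mem_r (functionalP fj vs xj) uv).
apply: (exI (x := x i)); rewrite tpair_inter; split=> //.
iex (opair_ex (x i) s _) as p hp; apply/(tpairP _ _ hp); rewrite tmem_ran.
have iU : tmem U e (x i) w by rewrite tmem_dom; apply: exI xi.
have jV : tmem V e (x j) w by rewrite tmem_dom; apply: exI xj.
apply: (exI (x := x j)); rewrite tpair_inter; split; first exact/(tpair_uwv _ _ _ _ hp).
by apply/(tpair_uvw _ _ _ _ hp); split=> //; rewrite tpair_mem.
Qed.

Lemma separates_eq n (S : op_term n) k (P : 'I_k -> op_term n) i j :
  exists E, separates E S P (i ≐ j).
Proof.
pose N := tapp op_inter (P i) (tapp op_pair (P j) (P j)).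
exists (tapp op_ran N N) => e x s w sS rep; rewrite tmem_ran.
have [fi xi] := rep i; have [fj xj] := rep j.
split=> H.
  iex H as u H; rewrite tpair_inter in H; have [ui uj] := H.
  exact: equal_trans (functionalP fi xi ui) (functionalP fj uj xj).
apply: (exI (x := x i)); rewrite tpair_inter; split=> //.
exact: tpair_congr (equal_sym H) (equal_refl s w) xj.
Qed.

(** The point <y,s> represents the environment with y put in front: coordinate 0 reads off y, and
    the old coordinates ignore it. Functionality comes from splitting an arbitrary point into its
    components. *)
Lemma represents_cons n (S Y : op_term n) k (P : 'I_k -> op_term n) e x s y r w :
  tmem S e s w -> represents P e x s w -> tmem Y e y w -> Opair r y s w ->
  represents (insert ord0 (tapp op_uvw (tapp op_eq Y Y) S) (fun j => tapp op_uwv (P j) Y))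
    e (y ;; x) r w.
Proof.
move=> sS rep yY hr; apply: ord_shiftP => [|j].
  rewrite insert_ord0; split; last first.
    apply/(tpair_uvw _ _ _ _ hr); split=> //; rewrite tpair_eq; do 2!split=> //.
    exact: equal_refl.
  move=> a b c; iintro ha; iintro hb.
  have h := tpair_uvw_opair ha; iex h as v h; iex h as z hc.
  have [va _] := (tpair_uvw _ _ _ _ hc).1 ha; have [vb _] := (tpair_uvw _ _ _ _ hc).1 hb.
  rewrite tpair_eq in va; rewrite tpair_eq in vb.
  by have [_ [_ ea]] := va; have [_ [_ eb]] := vb; ieq.
rewrite insert_shift; have [fj xj] := rep j; split; last exact/(tpair_uwv _ _ _ _ hr).
move=> a b c; iintro ha; iintro hb.
have h := tpair_uwv_opair ha; iex h as z h; iex h as v hc.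
have [va _] := (tpair_uwv _ _ _ _ hc).1 ha; have [vb _] := (tpair_uwv _ _ _ _ hc).1 hb.
exact: functionalP fj va vb.
Qed.

(** [S] and [P] stay general in the induction, because a bounded quantifier replaces them by Y × S
    and the extended coordinates. *)
Lemma Sigma0_separates k (A : form k) : Sigma0 A ->
  forall n (S : op_term n) (P : 'I_k -> op_term n), exists E, separates E S P A.
Proof.
(* The set Y = ⋃ dom(P_b) does not depend on the point and contains every element of every value of
   x_b. *)
have range n (S : op_term n) k' (P : 'I_k' -> op_term n) (b : 'I_k') e (x : nat -> nat) s y w :
    represents P e x s w -> Elem y (x b) w ->
    tmem (tapp op_union (tapp op_dom (P b) (P b)) S) e y w.
  move=> rep yb; rewrite tmem_bigunion; apply: (exI (x := x b)); split=> //.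
  by rewrite tmem_dom; have [_ xb] := rep b; apply: exI xb.
elim=> {k A}.
- move=> k n S P; exists (tapp op_diff S S) => e x s w _ _; by rewrite tmem_diff.
- by move=> k i j n S P; apply: separates_mem.
- by move=> k i j n S P; apply: separates_eq.
- move=> k A B _ IA _ IB n S P; have [EA hA] := IA n S P; have [EB hB] := IB n S P.
  exists (tapp op_inter EA (tapp op_pair EB EB)) => e x s w sS rep; rewrite tmem_inter.
  have EAx := hA e x s w sS rep; have EBx := hB e x s w sS rep.
  by split=> -[ha hb]; split; [apply/EAx|apply/EBx|apply/EAx|apply/EBx].
- move=> k A B _ IA _ IB n S P; have [EA hA] := IA n S P; have [EB hB] := IB n S P.
  exists (tapp op_union (tapp op_pair EA EB) EA) => e x s w sS rep; rewrite tmem_union.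
  split=> H; ior H as H|H.
  + by apply: orI1; apply/(hA e x s _ sS rep).
  + by apply: orI2; apply/(hB e x s _ sS rep).
  + by apply: orI1; apply/(hA e x s _ sS rep).
  + by apply: orI2; apply/(hB e x s _ sS rep).
- move=> k A B _ IA _ IB n S P; have [EA hA] := IA n S P; have [EB hB] := IB n S P.
  exists (tapp op_imp S (tapp op_pair (tapp op_pair EA EA) (tapp op_pair EA EB))).
  move=> e x s w sS rep; rewrite tmem_imp; split=> [[_ H]|H].
    by iintro a; apply/(hB e x s _ sS rep)/(mp H)/(hA e x s _ sS rep).
  by split=> //; iintro a; apply/(hB e x s _ sS rep)/(mp H)/(hA e x s _ sS rep).
- move=> k b A _ IA n S P.
  pose Y := tapp op_union (tapp op_dom (P b) (P b)) S; pose S' := tapp op_prod Y S.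
  pose P' := insert ord0 (tapp op_uvw (tapp op_eq Y Y) S) (fun j => tapp op_uwv (P j) Y).
  (* As Y is only an upper bound for x_b, the guard y ∈ x_b is kept as an atomic formula, separated
     by [EM]; [E'] then separates its implication of the body. *)
  have [EA hA] := IA n S' P'; have [EM hM] := separates_mem S' P' v0 ↑b.
  pose E' := tapp op_imp S' (tapp op_pair (tapp op_pair EM EM) (tapp op_pair EM EA)).
  exists (tapp op_inter S (tapp op_sections E' Y)) => e x s w sS rep; rewrite tmem_sections.
  split=> [[_ H] y|H].
    iintro yb; have yY := range _ S _ _ _ _ _ _ _ _ rep yb.
    iex (opair_ex y s _) as r hr; have rep' := represents_cons sS rep yY hr.
    have h := (tpairP _ _ hr).2 (mp (H y) yY); rewrite tmem_imp in h; have [rS h'] := h.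
    by apply/(hA e _ r _ rS rep')/(mp h')/(hM e _ r _ rS rep').
  split=> // y; iintro yY; iex (opair_ex y s _) as r hr.
  have rep' := represents_cons sS rep yY hr.
  have rS : tmem S' e r w by apply/(tpairP _ _ hr); rewrite tpair_prod.
  apply/(tpairP _ _ hr); rewrite tmem_imp; split=> //; iintro h.
  apply/(hA e _ r _ rS rep')/(mp (H y)); exact/(hM e _ r _ rS rep').
- move=> k b A _ IA n S P.
  pose Y := tapp op_union (tapp op_dom (P b) (P b)) S; pose S' := tapp op_prod Y S.
  pose P' := insert ord0 (tapp op_uvw (tapp op_eq Y Y) S) (fun j => tapp op_uwv (P j) Y).
  have [EA hA] := IA n S' P'; have [EM hM] := separates_mem S' P' v0 ↑b.
  (* Points <y,s> that satisfy both guard and body; intersecting with [S'] keeps only genuine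
     points, and the range returns s. *)
  pose E1 := tapp op_inter EM (tapp op_pair EA EA).
  pose E' := tapp op_inter S' (tapp op_pair E1 E1).
  exists (tapp op_ran E' E') => e x s w sS rep; rewrite tmem_ran.
  split=> H.
    iex H as y H; rewrite !tpair_inter tpair_prod in H; have [[yY _] [HM HA]] := H.
    iex (opair_ex y s _) as r hr; have rep' := represents_cons sS rep yY hr.
    have rS : tmem S' e r w by apply/(tpairP _ _ hr); rewrite tpair_prod.
    apply: (exI (x := y)); split.
      by apply/(hM e _ r _ rS rep')/(tpairP _ _ hr).
    by apply/(hA e _ r _ rS rep')/(tpairP _ _ hr).
  iex H as y [yb H]; have yY := range _ S _ _ _ _ _ _ _ _ rep yb.
  iex (opair_ex y s _) as r hr; have rep' := represents_cons sS rep yY hr.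
  have rS : tmem S' e r w by apply/(tpairP _ _ hr); rewrite tpair_prod.
  apply: (exI (x := y)); apply/(tpairP _ _ hr); rewrite !tmem_inter; split=> //.
  by split; [apply/(hM e _ r _ rS rep')|apply/(hA e _ r _ rS rep')].
Qed.

(** * The separating term over the given set *)

Lemma tmem_single n (j : 'I_n) e x w :
  tmem (tapp op_pair (tvar j) (tvar j)) e x w <-> Equal x (e j) w.
Proof.
have hj : tvalue (tvar j) e (e j) w by apply: equal_refl.
split=> H; last by apply/(tapp_mem op_pair x hj hj)/orI1.
by have {}H := (tapp_mem _ _ hj hj).1 H; ior H as H|H.
Qed.

(* The n of the informal statement is n.+1, the variables x_1, ..., x_n are
   'I_n.+1 and [i] is the distinguished one. The sequent lives in the context
   where variable 0 is the parameter a and variable [↑j] is the j-th of the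
   x_k with k != i; under the comprehension binder, [v0] is x_i. *)
Theorem mainTheorem6 (n : nat) (phi : form n.+1) (i : 'I_n.+1) :
  Sigma0 phi ->
  exists G : op_term n.+1,
    IKP_minus_Inf ⊢
      term_eq_class G (v0 ∈ ↑v0 ∧ ren (insert i v0 (fun j => ↑↑j)) phi).
Proof.
move=> Sphi; pose a : op_term n.+1 := tvar v0.
pose P := insert i (tapp op_eq a a)
  (fun j => tapp op_prod (tapp op_pair (tvar ↑j) (tvar ↑j)) a).
have [E hE] := Sigma0_separates Sphi a P.
(* [separates] speaks only of elements of [a], so the intersection discards anything else that [E]
   may contain. *)
pose G := tapp op_inter a (tapp op_pair E E); exists G.
apply: sem_complete => r; set w := [::].
pose e : 'I_n.+1 -> nat := fun j => r j.
have tmem_a x u : tmem a e x u <-> Elem x (r 0) u.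
  by symmetry; apply: tvalue_mem; apply: equal_refl.
have memG s v : tmem G e s v <->
    And (Elem s (r 0)) (sem (ren (insert i v0 (fun j => ↑↑j)) phi) (s ;; r)) v.
  (* The environment of [phi] at s: x_i is s and the other variables take their parameters. [inord]
     is there because environments are functions on [nat]. *)
  pose x m := insert i s (fun j => r (↑j)) (inord m).
  have -> : sem (ren (insert i v0 (fun j => ↑↑j)) phi) (s ;; r) = sem phi x.
    apply: sem_ren => k; rewrite /x inord_val /insert.
    by case: (unliftP i k) => [j|].
  rewrite tmem_inter.
  have rep : tmem a e s v -> represents P e x s v.
    move=> sa k; rewrite /P /x inord_val /insert; case: (unliftP i k) => [j _|_]; split.
    - move=> b c d; rewrite !tpair_prod; iintro [hb _]; iintro [hc _].
      exact: equal_trans ((tmem_single _ _ _ _).1 hb) (equal_sym ((tmem_single _ _ _ _).1 hc)).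
    - rewrite tpair_prod; split=> //; apply/tmem_single; exact: equal_refl.
    - move=> b c d; rewrite !tpair_eq; iintro [_ [_ hb]]; iintro [_ [_ hc]].
      exact: equal_trans (equal_sym hb) hc.
    - rewrite tpair_eq; do 2!split=> //; exact: equal_refl.
  split=> -[sa H].
    split; first exact/tmem_a.
    by apply/(hE e x s v) => //; apply: rep.
  have {}sa := (tmem_a _ _).2 sa.
  by split=> //; apply/(hE e x s v) => //; apply: rep.
iex (tvalue_ex G e _) as z hz; apply: (exI (x := z)); split=> x.
  change (Iff (sem (term_graph G (fun j => ↑↑j) v0) (x ;; z ;; r)) (Equal x z) w).
  rewrite sem_term_graph; split; iintro H; first exact: tvalue_unique H hz.
  exact: tvalue_congr (equal_sym H) hz.
set A := (_ ∧ _); change (Iff (Elem x z) (sem (ren (up shift) A) (x ;; z ;; r)) w).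
have -> : sem (ren (up shift) A) (x ;; z ;; r) = sem A (x ;; r).
  by apply: sem_ren; apply: ord_shiftP => [|j]; rewrite ?up_v0 // up_shift.
by split; iintro H; [apply/memG/(tvalue_mem x hz)|apply/(tvalue_mem x hz)/memG].
Qed.
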